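(* Let $d,M\ge 1$. (1) There exists $N$ (depending only on $d$ and $M$) such that for every homogeneous polynomial $P\in\mathbb C[x_1,\dots,x_M]$ of degree $d$ there is a linear map (matrix) $U:\mathbb C^M\to\mathbb C^N$ with $$P(\mathbf x)=e_d(U\mathbf x),$$ where $e_d$ is the $d$-th elementary symmetric polynomial in $N$ variables. (2) Let $|\psi\rangle$ be a core state of $M$ modes whose stellar polynomial $P_\psi$ has degree $d$, and suppose its homogenization satisfies $P_\psi^h(\mathbf y)=e_d(U\mathbf y)$ for some matrix $U$ with $N$ rows. Then $|\psi\rangle$ can be prepared (up to a nonzero scalar) from the multimode vacuum of the target modes and ancillary modes using $N$ photon additions and $N$ multiport interferometers, one photon-number projection of an ancillary mode onto the Fock state with $N-d$ photons, and additionally, if $P_\psi$ is not homogeneous, one displacement and one projection onto zero photons (both on a second ancillary mode). (3) If the stellar polynomial $P_\psi$ is homogeneous of degree $d$ and irreducible, and $N$ is the smallest integer for which a decomposition $P_\psi(\mathbf x)=e_d(U\mathbf x)$ with $U:\mathbb C^M\to\mathbb C^N$ exists, then the preparation in (2) is the shortest single-ancilla protocol: every single-ancilla protocol preparing $|\psi\rangle$ uses at least $N$ photon additions.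
   Context: Modes and states. Each bosonic mode $j$ has creation/annihilation operators $\hat a_j^\dagger,\hat a_j$ with $[\hat a_j,\hat a_k^\dagger]=\delta_{jk}$; $|\mathbf 0\rangle$ is the multimode vacuum and $|n\rangle=(\hat a^\dagger)^n|0\rangle/\sqrt{n!}$. A core state of $M$ modes is a nonzero vector with finite support in the Fock basis, $|\psi\rangle=\sum_{\mathbf n}\psi_{\mathbf n}|\mathbf n\rangle$. Its stellar polynomial is $P_\psi(\mathbf x)=\sum_{\mathbf n}\frac{\psi_{\mathbf n}}{\sqrt{\mathbf n!}}\mathbf x^{\mathbf n}$, so that $|\psi\rangle=P_\psi(\hat a_1^\dagger,\dots,\hat a_M^\dagger)|\mathbf 0\rangle$. States are considered up to nonzero scalars. Operations. Photon addition on mode $j$: $|\phi\rangle\mapsto\hat a_j^\dagger|\phi\rangle$. Multiport interferometer: a unitary on Fock space fixing the vacuum and acting by a unitary matrix $V$ as $\hat a_j^\dagger\mapsto\sum_k V_{kj}\hat a_k^\dagger$ (possibly on all modes, including ancillary ones). Projection of mode $j$ onto $n$ photons: $|\phi\rangle\mapsto\langle n|_j|\phi\rangle$ (a vector of the remaining modes). Displacement on mode $j$: $\hat D_j(\beta)=\exp(\beta\hat a_j^\dagger-\beta^*\hat a_j)$, $\beta\in\mathbb C$. Single-ancilla protocol: start from the vacuum of the $M$ target modes and one ancillary mode, apply any finite sequence of photon additions and multiport interferometers on these $M+1$ modes, then project the ancillary mode onto a Fock state $|n\rangle$ for some $n\ge0$. Its length is its number of photon additions. Homogenization: for $P=\sum_{\mathbf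 n}p_{\mathbf n}\mathbf x^{\mathbf n}$ of degree $d$, $P^h(y,\mathbf x)=\sum_{\mathbf n}p_{\mathbf n}y^{d-|\mathbf n|}\mathbf x^{\mathbf n}$ (if $P$ is homogeneous, $P^h=P$ and no extra variable is needed). $e_d(z_1,\dots,z_N)=\sum_{1\le j_1<\dots<j_d\le N}z_{j_1}\cdots z_{j_d}$. *)

(* Defs.v *)
From HB Require Import structures.
From mathcomp Require Import all_boot all_order all_algebra.
From mathcomp Require Import spectral complex mpoly.
From mathcomp Require Import classical_sets functions cardinality fsbigop filter.
From mathcomp Require Import reals ereal topology esum.

Set Implicit Arguments.
Unset Strict Implicit.
Unset Printing Implicit Defensive.

Import Order.TTheory GRing.Theory Num.Theory.

Local Open Scope classical_set_scope.
Local Open Scope complex_scope.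
Local Open Scope ring_scope.

(* An [m]-mode vector is given by its Fock-basis amplitudes:
   [phi n] is <n|phi>.  Square-summability is imposed separately, by [l2],
   because the creation and annihilation operators are unbounded. *)
Definition fock (R : realType) (m : nat) := 'X_{1..m} -> R[i].

Section Fock.
Variables (R : realType) (m : nat).
Implicit Types (phi chi psi : fock R m) (j : 'I_m) (n : 'X_{1..m}).

Definition vacuum : fock R m := fun n => (n == 0%MM)%:R.

Definition normsq phi : \bar R :=
  \esum_(n in [set: 'X_{1..m}]) (Normc.normc (phi n) ^+ 2)%:E.

Definition l2 phi : Prop := (normsq phi < +oo)%E.

(* When [n j = 0] the subtraction is truncated, but the factor vanishes. *)
Definition create j phi : fock R m :=
  fun n => sqrtC (n j)%:R * phi (n - U_(j))%MM.

Definition annihilate j phi : fock R m :=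
  fun n => sqrtC (n j).+1%:R * phi (n + U_(j))%MM.

Definition proportional phi psi : Prop :=
  exists2 c : R[i], c != 0 & forall n, phi n = c * psi n.

Definition core_state psi : Prop :=
  finite_set [set n | psi n != 0] /\ exists n, psi n != 0.

(* On a core state the sum is over the finite Fock support. *)
Definition stellar psi : {mpoly R[i][m]} :=
  \sum_(n \in [set: 'X_{1..m}])
    (psi n / sqrtC (\prod_(i < m) (n i)`!)%:R) *: 'X_[n].

(* A unitary of the Hilbert space is a surjective linear isometry.  The last
   clause is [T a_j^dag T^* = \sum_k V_kj a_k^dag], composed with [T] on the
   right, on the domain of [a_j^dag]. *)
Definition interferometer (V : 'M[R[i]]_m) (T : fock R m -> fock R m) : Prop :=
  [/\ V \is unitarymx,
      [/\ forall (c : R[i]) phi chi, l2 phi -> l2 chi ->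
            T (fun n => c * phi n + chi n) = (fun n => c * T phi n + T chi n),
          forall phi, l2 phi -> normsq (T phi) = normsq phi
        & forall chi, l2 chi -> exists2 phi, l2 phi & T phi = chi],
      T vacuum = vacuum
    & forall j phi, l2 phi -> l2 (create j phi) ->
        T (create j phi) = (fun n => \sum_(k < m) V k j * create k (T phi) n)].

(* [reachable p q phi]: some sequence of [p] photon additions and [q]
   interferometers, in any order, maps the vacuum to [phi]. *)
Inductive reachable : nat -> nat -> fock R m -> Prop :=
| reachable_vacuum : reachable 0 0 vacuum
| reachable_create p q phi j :
    reachable p q phi -> reachable p.+1 q (create j phi)
| reachable_interferometer p q phi V T :
    reachable p q phi -> interferometer V T -> reachable p q.+1 (T phi).

Definition displacement_generator j (beta : R[i]) phi : fock R m :=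
  fun n => beta * create j phi n - beta^* * annihilate j phi n.

(* [chi = exp (beta a_j^dag - beta^* a_j) phi], the exponential series
   converging in norm; vectors with finite Fock support are analytic vectors of
   the generator, so that on them the series gives the displacement operator. *)
Definition displaced j (beta : R[i]) phi chi : Prop :=
  (fun K : nat => normsq (fun n =>
     \sum_(k < K) (k`!%:R)^-1 * iter k (displacement_generator j beta) phi n
     - chi n)) @ \oo --> 0%E.

End Fock.

Definition insert_mnm (m : nat) (j : 'I_m.+1) (k : nat) (n : 'X_{1..m}) :
    'X_{1..m.+1} :=
  [multinom (if unlift j i is Some i' then n i' else k) | i < m.+1].

(* <k|_j; the remaining modes are renumbered along [lift j]. *)
Definition project (R : realType) (m : nat) (j : 'I_m.+1) (k : nat)
    (phi : fock R m.+1) : fock R m :=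
  fun n => phi (insert_mnm j k n).

(* The ancilla is the last of the [M.+1] modes. *)
Definition single_ancilla (R : realType) (M p q k : nat) (psi : fock R M) :
    Prop :=
  exists2 phi : fock R M.+1,
    reachable p q phi & proportional (project ord_max k phi) psi.

(* Mode [0] is the second ancilla (the displaced one), the last mode is the
   first ancilla, and the target modes are in between. *)
Definition two_ancilla (R : realType) (M p q k : nat) (psi : fock R M) : Prop :=
  exists2 phi : fock R M.+2, reachable p q phi &
    exists (beta : R[i]) (chi : fock R M.+1),
      displaced ord0 beta (project ord_max k phi) chi /\
      proportional (project ord0 0 chi) psi.

(* The homogenizing variable is ['X_0]. *)
Definition homogenize (K : fieldType) (M : nat) (P : {mpoly K[M]}) :
    {mpoly K[M.+1]} :=
  \sum_(n <- msupp P)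
    P@_n *: 'X_[insert_mnm ord0 ((msize P).-1 - mdeg n) n].

Definition esym_lin (K : fieldType) (N M d : nat) (U : 'M[K]_(N, M)) :
    {mpoly K[M]} :=
  mesym N K d \mPo [tuple \sum_(j < M) U i j *: 'X_j | i < N].

Definition mpoly_irreducible (K : fieldType) (M : nat) (P : {mpoly K[M]}) :
    Prop :=
  [/\ P != 0, P \isn't a GRing.unit
    & forall A B : {mpoly K[M]}, P = A * B ->
        A \is a GRing.unit \/ B \is a GRing.unit].

(* Main.v *)
Require Import Defs.
From HB Require Import structures.
From mathcomp Require Import all_boot all_order all_algebra.
From mathcomp Require Import spectral complex ssrcomplements mpoly.
From mathcomp Require Import ring lra zify.
From mathcomp Require Import finmap.
From mathcomp Require Import boolp classical_sets cardinality fsbigop.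
From mathcomp Require Import reals ereal esum sequences normedtype.

(* (1) By polarisation, [P] is a sum of [d]-th powers of linear forms.  If the
   [r_k] are the roots of [X^d + 1], then [\prod_k (1 - r_k l t) = 1 + l^d t^d],
   so the forms [- r_k l_b] taken together have [\sum_b l_b^d] as their [d]-th
   elementary symmetric polynomial.

   (2) A single photon can be rotated into any prescribed mode, hence [N] pairs
   (photon addition, interferometer) produce any product of [N] nonzero linear
   forms in the creation operators.  Taking the forms [l_i + b], where [b] is
   the creation operator of the ancilla, the coefficient of [b^(N-d)] is
   [e_d(l_1, ..., l_N)].  In the inhomogeneous case, displacing the second
   ancilla by [-1] and projecting it onto the vacuum sets the homogenizing
   variable to [1], up to a factor: [<0|exp(a - a^dag)|p> = l * p(1)] with
   [l != 0] for every polynomial [p] in the mode.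

   (3) Conversely a single-ancilla protocol with [p] additions yields the
   coefficient of some power of [y] in a product of [p] linear forms
   [l_i + c_i y].  If no [c_i] vanishes, dividing by the [c_i] exhibits it as an
   elementary symmetric polynomial of [p] forms.  Otherwise it is divisible by
   some [l_i], so that by irreducibility it is linear and [N <= 1]. *)

Set Implicit Arguments.
Unset Strict Implicit.
Unset Printing Implicit Defensive.

Import Order.TTheory GRing.Theory Num.Theory.
Local Open Scope classical_set_scope.
Local Open Scope complex_scope.
Local Open Scope ring_scope.

(** * Symmetric polynomials of linear forms *)

Section ProdLinear.
Variables (A : comNzRingType) (I : finType).
Implicit Types (a b : I -> A).

Lemma coef_prod_linear a b k :
  (\prod_i ((a i)%:P + b i *: 'X))`_k =
  \sum_(J : {set I} | #|J| == k) \prod_i (if i \in J then b i else a i).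
Proof.
have -> : \prod_i ((a i)%:P + b i *: 'X) =
    \sum_(J : {set I}) (\prod_i (if i \in J then b i else a i)) *: 'X^#|J|.
  under eq_bigr do rewrite addrC.
  rewrite bigA_distr; apply: eq_bigr => J _.
  rewrite -mul_polyC rmorph_prod -prodr_const [X in _ * X]big_mkcond -big_split.
  by apply: eq_bigr => i _ /=; case: ifP => _; rewrite ?mulr1 // mul_polyC.
rewrite coef_sum [RHS]big_mkcond; apply: eq_bigr => J _.
by rewrite coefZ coefXn eq_sym; case: eqP; rewrite ?mulr1 ?mulr0.
Qed.

(** Complementing the set [J] of factors that contribute ['X] exchanges the roles of [a] and [b];
    this reverses the coefficients. *)
Lemma coef_prod_linearC a b k : (k <= #|I|)%N ->
  (\prod_i ((a i)%:P + b i *: 'X))`_k =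
  (\prod_i ((b i)%:P + a i *: 'X))`_(#|I| - k).
Proof.
move=> kI; rewrite !coef_prod_linear (reindex_inj (@finset.setC_inj I)) /=.
apply: eq_big => [J|J _].
  have E := cardsC J; apply/eqP/eqP => H; first by rewrite -E H addnK.
  by apply/eqP; rewrite -(eqn_add2l #|J|) E H subnK.
by apply: eq_bigr => i _; rewrite finset.in_setC if_neg.
Qed.

Lemma coef_prod_1powX (q : I -> A) d :
  (0 < d)%N -> (\prod_i (1 + q i *: 'X^d))`_d = \sum_i q i.
Proof.
move=> d0; have [r ->] : exists r : {poly A},
    \prod_i (1 + q i *: 'X^d) = 1 + (\sum_i q i) *: 'X^d + 'X^(d.+1) * r.
  apply: (big_rec2 (fun x y => exists r, y = 1 + x *: 'X^d + 'X^(d.+1) * r)).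
    by exists 0; rewrite scale0r mulr0 !addr0.
  (* Since [d = e.+1], the cross term ['X^d * 'X^d] equals ['X^(d.+1) * 'X^e]: for [0 < d] the
     factors combine additively modulo ['X^(d.+1)]. *)
  move=> i x y _ [r ->]; have [e ->] : exists e, d = e.+1 by case: d d0 => // e; exists e.
  exists (r + (q i * x) *: 'X^e + q i *: 'X^(e.+1) * r).
  rewrite scalerDl -!mul_polyC polyCM !exprS; ring.
rewrite !coefD coef1 coefZ coefXn eqxx coefXnM ltnS leqnn addr0 mulr1.
by rewrite -[_ == _]negbK -lt0n d0 add0r.
Qed.

End ProdLinear.

(** * The polarisation identity *)

Section Polarisation.
Variables (A : comNzRingType) (d : nat).

(** After expanding the power over maps [f], the signed sum over the sets [S] containing the image
    of [f] is a product of factors [1 - [i outside the image]]. It vanishes unless [f] is onto,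
    hence a permutation. The cardinal on the right is the factorial of [d], in the form in which it
    arises. *)
Lemma polarisation (y : 'I_d -> A) :
  \sum_(S : {set 'I_d}) (\prod_i (if i \in S then 1 else -1)) *
     (\sum_(i in S) y i) ^+ d =
  (\prod_i y i) *+ #|[pred f : {ffun 'I_d -> 'I_d} | injectiveb f]|.
Proof.
have E (S : {set 'I_d}) : (\sum_(i in S) y i) ^+ d =
    \sum_(f : {ffun 'I_d -> 'I_d})
       (\prod_k y (f k)) * \prod_k (f k \in S)%:R.
  rewrite big_mkcond /=; set x := \sum_i _.
  have -> : x ^+ d = \prod_(k < d) x by rewrite prodr_const card_ord.
  rewrite bigA_distr_bigA /=; apply: eq_bigr => f _.
  rewrite -big_split; apply: eq_bigr => k _ /=.
  by case: (f k \in S); rewrite ?mulr1 ?mulr0.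
transitivity (\sum_(S : {set 'I_d}) \sum_(f : {ffun 'I_d -> 'I_d})
    (\prod_i (if i \in S then 1 else -1)) *
    ((\prod_k y (f k)) * \prod_k (f k \in S)%:R)).
  by apply: eq_bigr => S _; rewrite -mulr_sumr -E.
rewrite exchange_big /= -sumr_const [RHS]big_mkcond /=; apply: eq_bigr => f _.
have -> : \sum_(S : {set 'I_d}) (\prod_i (if i \in S then 1 else -1)) *
     (\prod_k y (f k) * \prod_k (f k \in S)%:R) =
   \prod_k y (f k) * \prod_i (1 + - (i \notin codom f)%:R).
  rewrite bigA_distr mulr_sumr; apply: eq_bigr => S _.
  rewrite mulrCA; congr (_ * _).
  have [sub|/subsetPn [i /codomP [k ->] kS]] := boolP (codom f \subset S).
    rewrite [X in _ * X]big1 ?mulr1 => [|k _]; last first.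
      by rewrite (fintype.subsetP sub) ?codom_f.
    apply: eq_bigr => i _; case: ifP => // /negbT iS.
    by rewrite (contra (fintype.subsetP sub i)).
  rewrite [X in _ * X](bigD1 k) //= (negPf kS) mul0r mulr0.
  by rewrite (bigD1 (f k)) //= (negPf kS) codom_f oppr0 mul0r.
rewrite inE; case: injectiveP => [inj|ninj].
  have [g fK gK] : bijective f by apply: injF_bij.
  rewrite [X in _ * X]big1 ?mulr1.
    by rewrite [RHS](reindex f) //; exists g => x _; rewrite ?fK ?gK.
  by move=> i _; rewrite -(gK i) codom_f /= subr0.
have /forallPn [i ic] : ~~ [forall i, i \in codom f].
  apply/negP => /forallP sur; apply: ninj; apply/injectiveP.
  apply/card_uniqP; rewrite -/(codom f) size_codom.
  by apply: eq_card => j; rewrite sur.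
by rewrite [X in _ * X](bigD1 i) //= ic subrr mul0r mulr0.
Qed.

End Polarisation.

(** * Linear forms and their elementary symmetric polynomials *)

Section LinearForm.
Variables (K : fieldType) (M : nat).
Implicit Types (v w : 'rV[K]_M).

Definition lform v : {mpoly K[M]} := \sum_(j < M) v 0 j *: 'X_j.

Lemma lform_is_linear : linear lform.
Proof.
move=> c v w; rewrite /lform scaler_sumr -big_split; apply: eq_bigr => j _.
by rewrite !mxE scalerDl scalerA.
Qed.
HB.instance Definition _ :=
  GRing.isLinear.Build K 'rV[K]_M {mpoly K[M]} _ lform lform_is_linear.

Lemma lform_delta j : lform (delta_mx 0 j) = 'X_j.
Proof.
rewrite /lform (bigD1 j) //= big1 ?addr0 => [|i /negPf ij].
  by rewrite mxE !eqxx scale1r.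
by rewrite mxE ij andbF scale0r.
Qed.

Lemma lform_homog v : lform v \is 1.-homog.
Proof. by apply: rpred_sum => j _; apply: rpredZ; rewrite dhomogX /= mdeg1. Qed.

Lemma esym_linE d N (U : 'M[K]_(N, M)) :
  esym_lin d U =
  \sum_(J : {set 'I_N} | #|J| == d) \prod_(i in J) lform (row i U).
Proof.
rewrite /esym_lin /mesym raddf_sum; apply: eq_bigr => J _.
rewrite /= rmorph_prod; apply: eq_bigr => i _ /=.
rewrite comp_mpolyXU -tnth_nth tnth_mktuple; apply: eq_bigr => j _.
by rewrite mxE.
Qed.

Lemma esym_lin_coef d N (U : 'M[K]_(N, M)) :
  esym_lin d U = (\prod_i (1%:P + lform (row i U) *: 'X))`_d.
Proof.
rewrite esym_linE coef_prod_linear; apply: eq_bigr => J _.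
by rewrite big_mkcond.
Qed.

(** The form that matches the protocol: ['X] stands for the creation operator of the ancilla, with
    coefficient [1] in every factor. *)
Lemma esym_lin_coef_rev d N (U : 'M[K]_(N, M)) : (d <= N)%N ->
  esym_lin d U = (\prod_i ((lform (row i U))%:P + 1 *: 'X))`_(N - d).
Proof.
by move=> dN; rewrite esym_lin_coef coef_prod_linearC card_ord.
Qed.

Lemma esym_lin_homog d N (U : 'M[K]_(N, M)) : esym_lin d U \is d.-homog.
Proof.
rewrite esym_linE; apply: rpred_sum => J /eqP <-.
rewrite -sum1_card; apply: (big_rec2 (fun x (y : {mpoly K[M]}) => y \is x.-homog)).
  exact: dhomog1.
by move=> i x y _ H; apply: dhomogM => //; apply: lform_homog.
Qed.

Lemma esym_lin_gt d N (U : 'M[K]_(N, M)) : (N < d)%N -> esym_lin d U = 0.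
Proof.
move=> Nd; rewrite esym_linE big1 // => J /eqP E.
by have := max_card (mem J); rewrite card_ord E leqNgt Nd.
Qed.

End LinearForm.

(** * From sums of powers to elementary symmetric polynomials *)

Section Waring.
Variables (K : closedFieldType).

(** The witnesses are the opposites of the roots of [X^d + 1]. As this polynomial is palindromic,
    reversing [\prod_i (r_i + X) = X^d + 1] gives [\prod_i (1 + r_i X) = 1 + X^d], and replacing [X]
    by [z X] multiplies the coefficient of degree [k] by [z ^+ k]. *)
Lemma roots_of_minus_one d : exists r : 'I_d -> K,
  forall (A : comAlgType K) (z : A), (0 < d)%N ->
  \prod_i (1 + (r i *: z) *: 'X) = 1 + z ^+ d *: 'X^d.
Proof.
case: d => [|d]; first by exists (fun=> 0) => A z; rewrite ltnn.
have [r] := closed_field_poly_normal ('X^(d.+1) + 1%:P : {poly K}).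
rewrite lead_coefXnaddC // scale1r => Er.
have sr : size r = d.+1.
  by apply/succn_inj; rewrite -(size_prod_XsubC r id) -Er size_XnaddC.
pose s (i : 'I_d.+1) := - r`_i; exists s => A z _.
have Es : \prod_i ((s i)%:P + 1 *: 'X) = 'X^(d.+1) + 1%:P.
  rewrite Er [RHS](big_nth 0) sr big_mkord; apply: eq_bigr => i _.
  by rewrite scale1r /s polyCN addrC.
apply/polyP => k.
rewrite [LHS]coef_prod_linear coefD coef1 coefZ coefXn.
have [kd|dk] := leqP k d.+1; last first.
  rewrite big1 => [|J /eqP E]; last first.
    by have := max_card (mem J); rewrite card_ord E leqNgt dk.
  by rewrite !gtn_eqF ?mulr0 ?addr0 // (leq_trans _ dk).
transitivity ((\prod_i ((1%:P + s i *: 'X : {poly K})))`_k *: z ^+ k).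
  rewrite coef_prod_linear scaler_suml; apply: eq_bigr => J /eqP <-.
  rewrite -!big_mkcond -prodr_const -scaler_prod; exact: eq_bigr.
rewrite coef_prod_linearC ?card_ord // Es coefD coefXn coefC.
have -> : (d.+1 - k == d.+1)%N = (k == 0)%N.
  by case: k kd => [|k] kd; rewrite ?subn0 ?eqxx // subSS ltn_eqF // ltnS leq_subr.
rewrite subn_eq0; have -> : (d.+1 <= k)%N = (k == d.+1) by rewrite eqn_leq kd.
case: eqP => [->|_]; first by rewrite addr0 scale1r mulr0 addr0 expr0.
by case: eqP => [->|_]; rewrite !add0r ?scale1r ?scale0r ?mulr1 ?mulr0.
Qed.

Lemma power_sum_esym_lin M d (B : finType) (l : B -> 'rV[K]_M) : (0 < d)%N ->
  exists U : 'M[K]_(#|{: B * 'I_d}|, M),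
    \sum_b lform (l b) ^+ d = esym_lin d U.
Proof.
move=> d0; have [r Hr] := roots_of_minus_one d.
pose f (x : B * 'I_d) := r x.2 *: l x.1.
exists (\matrix_i f (enum_val i)).
rewrite esym_lin_coef -(coef_prod_1powX _ d0).
under eq_bigr do rewrite -Hr //.
rewrite (pair_bigA _ (fun b i => 1 + (r i *: lform (l b)) *: 'X)) /=.
rewrite (reindex (fun i : 'I_#|{: B * 'I_d}| => enum_val i)) /=; last first.
  by exists enum_rank => x _; rewrite ?enum_rankK ?enum_valK.
apply: (congr1 (fun p : {poly {mpoly K[M]}} => p`_d)); apply: eq_bigr => i _.
by rewrite rowK linearZ.
Qed.

End Waring.

(** The variables of a monomial listed with multiplicity, ready for polarisation. *)
Lemma mpolyX_prod_seq (K : comNzRingType) M (n : 'X_{1..M}) :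
  {s : seq 'I_M | size s = mdeg n & 'X_[K, n] = \prod_(i <- s) 'X_i}.
Proof.
exists (flatten [seq nseq (n i) i | i <- enum 'I_M]).
  rewrite size_flatten /shape -map_comp sumnE big_map mdegE big_enum.
  by apply: eq_bigr => i _ /=; rewrite size_nseq.
rewrite big_flatten big_map big_enum mpolyXE_id; apply: eq_bigr => i _ /=.
by elim: (n i) => [|k IH] /=; rewrite ?big_nil // big_cons -IH exprS.
Qed.

Lemma homog_esym_lin (K : numClosedFieldType) M d : (0 < d)%N -> (0 < M)%N ->
  exists N, forall P : {mpoly K[M]}, P \is d.-homog ->
    exists U : 'M[K]_(N, M), P = esym_lin d U.
Proof.
(* [B] depends on [d] and the number of variables only, so [N] is uniform in [P]. *)
case: M => // M d0 _; pose B := ('X_{1..M.+1 < d.+1} * {set 'I_d})%type.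
exists #|{: B * 'I_d}| => P hP.
pose c : nat := #|[pred f : {ffun 'I_d -> 'I_d} | injectiveb f]|.
have c0 : c%:R != 0 :> K.
  rewrite pnatr_eq0 -lt0n; apply/card_gt0P; exists (finfun id).
  by rewrite inE; apply/injectiveP => x y; rewrite !ffunE.
(* The default [ord0] is harmless: a monomial with nonzero coefficient in [P] lists exactly [d]
   variables. *)
pose t (n : 'X_{1..M.+1}) (i : 'I_d) : 'I_M.+1 := nth ord0 (s2val (mpolyX_prod_seq K n)) i.
pose g (b : B) : K := c%:R^-1 * P@_b.1 * \prod_i (if i \in b.2 then 1 else -1).
(* The weight of each power is moved inside the linear form by a [d]-th root. *)
pose l (b : B) : 'rV[K]_M.+1 := d.-root (g b) *: \sum_(i in b.2) delta_mx 0 (t b.1 i).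
have [U EU] := power_sum_esym_lin l d0; exists U; rewrite -EU.
have El b : lform (l b) ^+ d = g b *: (\sum_(i in b.2) 'X_(t b.1 i)) ^+ d.
  rewrite linearZ /= exprZn rootCK // linear_sum /=; congr (_ *: _ ^+ _).
  by apply: eq_bigr => i _; rewrite lform_delta.
under eq_bigr do rewrite El.
rewrite -(pair_bigA _ (fun n S => g (n, S) *: (\sum_(i in S) 'X_(t n i)) ^+ d)) /=.
rewrite [LHS](mpolywE (k := d.+1)); last first.
  apply/bigmax_leqP_seq => n nP _; rewrite ltnS.
  by move/dhomogP: hP => /(_ n nP) /= ->.
apply: eq_bigr => n _.
have [Pn|Pn] := eqVneq P@_n 0.
  rewrite Pn scale0r big1 // => S _; by rewrite /g /= Pn mulr0 mul0r scale0r.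
have nd : mdeg n = d by move/dhomogP: hP; apply; rewrite mcoeff_msupp.
have -> : 'X_[n] = \prod_i 'X_(t n i) :> {mpoly K[M.+1]}.
  rewrite /t; case: mpolyX_prod_seq => s /= ss ->.
  by rewrite (big_nth ord0) ss nd big_mkord.
apply: (scalerI c0); rewrite scaler_nat scalerMnr -polarisation scaler_sumr.
rewrite scaler_sumr; apply: eq_bigr => S _.
rewrite scalerA !mulrA divff // mul1r -scalerA; congr (_ *: _).
rewrite -mul_mpolyC rmorph_prod; congr (_ * _); apply: eq_bigr => i _.
by case: (i \in S); rewrite /= ?rmorphN rmorph1.
Qed.

(** * Fock vectors as polynomials *)

Section Multinomials.
Variable m : nat.
Implicit Types n l : 'X_{1..m}.

Definition mfact n := (\prod_(i < m) (n i)`!)%N.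

Lemma mfact_gt0 n : (0 < mfact n)%N.
Proof. by rewrite prodn_gt0 // => i; rewrite fact_gt0. Qed.

Lemma mfactD n j : mfact (n + U_(j)) = ((n j).+1 * mfact n)%N.
Proof.
rewrite /mfact (bigD1 j) //= [in RHS](bigD1 j) //= mulnA.
rewrite mnmDE mnm1E eqxx addn1 factS; congr (_ * _)%N.
by apply: eq_bigr => i /negPf ij; rewrite mnmDE mnm1E eq_sym ij addn0.
Qed.

Lemma mnm_subK n j : n j != 0%N -> (n - U_(j) + U_(j))%MM = n.
Proof. by move=> nj; rewrite submK // lep1mP. Qed.

Lemma mdeg_subS n j : n j != 0%N -> (mdeg (n - U_(j))%MM).+1 = mdeg n.
Proof. by move=> /mnm_subK {2}<-; rewrite mdegD mdeg1 addn1. Qed.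

Lemma mdeg_gt0_ex n : (0 < mdeg n)%N -> exists j, n j != 0%N.
Proof.
move=> n0; apply/existsP; apply: contraLR n0; rewrite negb_exists => /forallP H.
by rewrite mdegE big1 // => i _; apply/eqP; rewrite -[_ == _]negbK H.
Qed.

Lemma mcoeff_mulX (K : comNzRingType) (P : {mpoly K[m]}) j n :
  ('X_j * P)@_n = if n j == 0%N then 0 else P@_(n - U_(j)).
Proof.
case: ifPn => [/eqP nj|/mnm_subK nj]; last by rewrite -{1}nj addmC mulrC mcoeffMX.
apply: memN_msupp_eq0; rewrite mulrC (perm_mem (msuppMX _ _)).
by apply/mapP => -[l _ El]; move: nj; rewrite El mnmDE mnm1E eqxx.
Qed.

End Multinomials.

(** * Norms of Fock vectors by photon-number truncation *)

Section NormSq.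
Variables (R : realType) (m : nat).
Implicit Types (phi chi : fock R m).

Lemma normc_sqr (x : R[i]) : (Normc.normc x ^+ 2)%:C = x * x^*.
Proof. by rewrite -[RHS]sqr_normc rmorphXn. Qed.

Lemma normsq_ge phi D :
  ((\sum_(n : 'X_{1..m < D}) Normc.normc (phi n) ^+ 2)%:E <= normsq phi)%E.
Proof.
apply: esum_ge; pose s := [seq bmnm n | n <- enum {: 'X_{1..m < D}}].
have us : uniq s by rewrite map_inj_uniq ?enum_uniq //; apply: val_inj.
exists [set` s]; first by split; [exact: finite_seq | exact: subsetT].
by rewrite -fsbig_seq // big_map big_enum sumEFin.
Qed.

(** Every finite set of multi-indices lies in some simplex [mdeg n < D], so these simplices suffice
    to compute the supremum. *)
Lemma normsq_le phi (c : \bar R) :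
  (forall D, ((\sum_(n : 'X_{1..m < D}) Normc.normc (phi n) ^+ 2)%:E <= c)%E) ->
  (normsq phi <= c)%E.
Proof.
move=> H; apply: ge_ereal_sup => _ [X [finX _]] <-.
rewrite fsbig_finite // sumEFin.
set s := finmap.enum_fset _.
pose D := (\max_(n <- s) mdeg n).+1.
apply: le_trans (H D); rewrite lee_fin.
rewrite (big_mksub ('X_{1..m < D} : subFinType _)) /=; last first.
- by move=> n ns; rewrite ltnS; apply: leq_bigmax_seq.
- exact: finmap.fset_uniq.
rewrite big_mkcond; apply: ler_sum => n _; case: ifP => // _.
by rewrite sqr_ge0.
Qed.

Lemma eq_normsq phi chi :
  (forall D, \sum_(n : 'X_{1..m < D}) Normc.normc (phi n) ^+ 2 =
             \sum_(n : 'X_{1..m < D}) Normc.normc (chi n) ^+ 2) ->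
  normsq phi = normsq chi.
Proof.
move=> H; apply/eqP; rewrite eq_le; apply/andP; split; apply: normsq_le => D.
  by rewrite H normsq_ge.
by rewrite -H normsq_ge.
Qed.

Lemma l2_bounded phi D : (forall n, phi n != 0 -> (mdeg n < D)%N) -> l2 phi.
Proof.
move=> H; apply: (@le_lt_trans _ _
  (\sum_(n : 'X_{1..m < D}) Normc.normc (phi n) ^+ 2)%:E); last exact: ltry.
apply: normsq_le => D'; rewrite lee_fin.
rewrite (bigID (fun n : 'X_{1..m < D'} => phi n == 0)) /=.
rewrite big1 ?add0r => [|n /eqP ->]; last by rewrite Normc.normc0 expr0n.
pose s := [seq bmnm n | n <- enum {: 'X_{1..m < D'}} & phi (bmnm n) != 0].
have us : uniq s.
  by rewrite (map_inj_uniq (val_inj : injective (@bmnm m D'))) filter_uniq ?enum_uniq.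
have -> : \sum_(n : 'X_{1..m < D'} | phi n != 0) Normc.normc (phi n) ^+ 2 =
          \sum_(n <- s) Normc.normc (phi n) ^+ 2.
  by rewrite big_map big_filter big_enum_cond.
rewrite (big_mksub ('X_{1..m < D} : subFinType _)) //=; last first.
  by move=> n /mapP [l]; rewrite mem_filter => /andP [/H lD _] ->.
rewrite big_mkcond; apply: ler_sum => n _; case: ifP => // _.
by rewrite sqr_ge0.
Qed.

End NormSq.

(** * The dictionary between polynomials and core states *)

Section FockOf.
Variables (R : realType) (m : nat).
Local Notation C := R[i].
Implicit Types (phi chi psi : fock R m) (P Q : {mpoly C[m]}) (n l : 'X_{1..m}).

(** The norm of the vector obtained by applying the monomial [n] in the creation operators to the
    vacuum; it converts polynomial coefficients into Fock amplitudes. *)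
Definition fnorm n : C := sqrtC (mfact n)%:R.

Lemma fnorm_neq0 n : fnorm n != 0.
Proof. by rewrite sqrtC_eq0 pnatr_eq0 -lt0n mfact_gt0. Qed.

Lemma fnormD n j : fnorm (n + U_(j))%MM = sqrtC (n j).+1%:R * fnorm n.
Proof. by rewrite /fnorm mfactD natrM sqrtCM // nnegrE ler0n. Qed.

Lemma fnorm0 : fnorm 0%MM = 1.
Proof. by rewrite /fnorm /mfact big1 ?sqrtC1 // => i _; rewrite mnm0E. Qed.

Lemma fnorm_conj n : (fnorm n)^* = fnorm n.
Proof. by apply: conj_Creal; rewrite sqrtC_real // ler0n. Qed.

Lemma fnorm_sqr n : fnorm n * fnorm n = (mfact n)%:R.
Proof. by rewrite -expr2 sqrtCK. Qed.

Definition fock_of P : fock R m := fun n => fnorm n * P@_n.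

Lemma l2_fock_of P : l2 (fock_of P).
Proof.
apply: (@l2_bounded _ _ _ (msize P)) => n.
by rewrite mulf_eq0 negb_or -mcoeff_msupp => /andP [_ /msize_mdeg_lt].
Qed.

Lemma fock_of1 : fock_of 1 = @vacuum R m.
Proof.
apply: funext => n; rewrite /fock_of mcoeff1 /vacuum.
by case: eqP => [->|_]; rewrite ?fnorm0 ?mulr1 ?mulr0.
Qed.

Lemma fock_ofZD (c : C) P Q :
  fock_of (c *: P + Q) = (fun n => c * fock_of P n + fock_of Q n).
Proof. by apply: funext => n; rewrite /fock_of mcoeffD mcoeffZ; ring. Qed.

(** Agreement of [phi] with [Q] is asked only one photon below [n], so that [phi] may have infinite
    support and [Q] be a truncation of it. *)
Lemma create_coef j phi Q n :
  (forall l, (mdeg l).+1 = mdeg n -> phi l = fnorm l * Q@_l) ->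
  create j phi n = fnorm n * ('X_j * Q)@_n.
Proof.
move=> H; rewrite /create mcoeff_mulX; case: ifPn => [/eqP ->|nj].
  by rewrite sqrtC0 mul0r mulr0.
rewrite H ?mdeg_subS // mulrA; congr (_ * _).
rewrite -[in RHS](mnm_subK nj) fnormD mnmBE mnm1E eqxx subn1 prednK //.
by rewrite lt0n.
Qed.

Lemma create_fock_of j P : create j (fock_of P) = fock_of ('X_j * P).
Proof. by apply: funext => n; apply: create_coef. Qed.

Lemma stellar_coef psi n : core_state psi ->
  (stellar psi)@_n = psi n / fnorm n.
Proof.
move=> [fin _]; rewrite /stellar.
pose F := fun n : 'X_{1..m} =>
  (psi n / sqrtC (\prod_(i < m) (n i)`!)%:R) *: 'X_[n] : {mpoly C[m]}.
rewrite -/F (@fsbigTE _ _ _ _ (fset_set [set n | psi n != 0])); last first.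
  move=> i; rewrite in_fset_set // notin_setE /= => /negP.
  by rewrite negbK /F => /eqP ->; rewrite mul0r scale0r.
rewrite raddf_sum /=.
have [nS|nS] := boolP (n \in fset_set [set n | psi n != 0]); last first.
  rewrite big1_seq => [|l /andP [_ lS]].
    move: nS; rewrite in_fset_set // notin_setE /= => /negP.
    by rewrite negbK => /eqP ->; rewrite mul0r.
  rewrite mcoeffZ mcoeffX; case: eqP => [El|_]; last by rewrite mulr0.
  by rewrite -El lS in nS.
rewrite [LHS](bigD1_seq n nS (finmap.fset_uniq _)) /= [X in _ + X]big1 ?addr0 => [|l ln].
  by rewrite mcoeffZ mcoeffX eqxx mulr1.
by rewrite mcoeffZ mcoeffX (negPf ln) mulr0.
Qed.

Lemma stellarK psi : core_state psi -> fock_of (stellar psi) = psi.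
Proof.
move=> cs; apply: funext => n; rewrite /fock_of stellar_coef // mulrC.
by rewrite divfK // fnorm_neq0.
Qed.

End FockOf.

(** * Linear substitutions and the Fischer pairing *)

Section Substitution.
Variables (K : fieldType) (m : nat).
Implicit Types (V W : 'M[K]_m) (P Q : {mpoly K[m]}) (n l : 'X_{1..m}).

(** Columns are used because an interferometer sends the creation operator of mode [j] to the
    combination with coefficients [V k j]. *)
Definition linsub V P := P \mPo [tuple lform (col j V)^T | j < m].

Lemma linsub_is_linear V : linear (linsub V).
Proof. by move=> c P Q; rewrite /linsub comp_mpolyD comp_mpolyZ. Qed.
HB.instance Definition _ V :=
  GRing.isLinear.Build K {mpoly K[m]} {mpoly K[m]} _ (linsub V)
    (linsub_is_linear V).

Lemma linsub_is_monoid_morphism V : monoid_morphism (linsub V).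
Proof. by split=> [|P Q]; rewrite /linsub ?rmorph1 ?rmorphM. Qed.
HB.instance Definition _ V :=
  GRing.isMonoidMorphism.Build {mpoly K[m]} {mpoly K[m]} (linsub V)
    (linsub_is_monoid_morphism V).

Lemma linsubXU V j : linsub V 'X_j = lform (col j V)^T.
Proof. by rewrite /linsub comp_mpolyXU -tnth_nth tnth_mktuple. Qed.

Lemma linsub_lform V (w : 'rV_m) : linsub V (lform w) = lform (w *m V^T).
Proof.
rewrite [in LHS]/lform raddf_sum /=.
under eq_bigr do rewrite linearZ /= linsubXU -linearZ /=.
rewrite -linear_sum /=; congr lform; apply/rowP => k.
by rewrite summxE mxE; apply: eq_bigr => j _; rewrite !mxE.
Qed.

Lemma linsub_homog V l : linsub V 'X_[l] \is (mdeg l).-homog.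
Proof.
rewrite /linsub comp_mpolyX mdegE.
apply: (big_rec2 (fun x (y : {mpoly K[m]}) => y \is x.-homog)).
  exact: dhomog1.
move=> i x y _ H; apply: dhomogM => //.
by have := dhomogMn (l i) (lform_homog (col i V)^T); rewrite tnth_mktuple mul1n.
Qed.

Lemma linsub_coef0 V l n : mdeg l != mdeg n -> (linsub V 'X_[l])@_n = 0.
Proof. by rewrite eq_sym; apply: dhomog_nemf_coeff; apply: linsub_homog. Qed.

(** Linear substitutions preserve the degree, so each coefficient depends on one homogeneous
    component only. *)
Lemma eq_linsub_coef V P Q n :
  (forall l, mdeg l = mdeg n -> P@_l = Q@_l) ->
  (linsub V P)@_n = (linsub V Q)@_n.
Proof.
move=> H; apply/eqP; rewrite -subr_eq0 -mcoeffB -linearB /=.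
rewrite [P - Q]mpolyE (linear_sum (linsub V)) /= raddf_sum big1 // => l _ /=.
rewrite linearZ mcoeffZ /=; have [ln|ln] := eqVneq (mdeg l) (mdeg n).
  by rewrite mcoeffB H // subrr mul0r.
by rewrite linsub_coef0 // mulr0.
Qed.

Lemma eq_rmorph_mpoly (A : comNzRingType) (f g : {rmorphism {mpoly K[m]} -> A}) :
  (forall c, f c%:MP = g c%:MP) -> (forall j, f 'X_j = g 'X_j) -> f =1 g.
Proof.
move=> HC HX P; rewrite [P]mpolyE !rmorph_sum; apply: eq_bigr => l _.
rewrite -mul_mpolyC !rmorphM HC mpolyXE_id !rmorph_prod; congr (_ * _).
by apply: eq_bigr => j _; rewrite !rmorphXn HX.
Qed.

Lemma linsubM V W P : linsub V (linsub W P) = linsub (V *m W) P.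
Proof.
pose f : {rmorphism {mpoly K[m]} -> {mpoly K[m]}} := linsub V \o linsub W.
apply: (@eq_rmorph_mpoly _ f (linsub (V *m W))) => [c|j] /=.
  by rewrite /linsub !comp_mpolyC.
by rewrite !linsubXU linsub_lform -trmx_mul colE mulmxA -colE.
Qed.

Lemma linsub1 P : linsub 1%:M P = P.
Proof.
apply: (@eq_rmorph_mpoly _ (linsub 1%:M) idfun) => [c|j] /=.
  by rewrite /linsub comp_mpolyC.
by rewrite linsubXU -lform_delta; congr lform; apply/rowP => k; rewrite !mxE eq_sym.
Qed.

Lemma deriv_lform k (w : 'rV[K]_m) : (lform w)^`M(k) = (w 0 k)%:MP.
Proof.
rewrite /lform raddf_sum (bigD1 k) //= big1 ?addr0 => [|i ik].
  rewrite mderivZ mderivX mnm1E eqxx scale1r.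
  by rewrite -[X in (X - _)%MM]add0m addmK mpolyX0 -mul_mpolyC mulr1.
by rewrite mderivZ mderivX mnm1E (negPf ik) scale0r scaler0.
Qed.

(** The chain rule, by induction on the degree: split off one variable and apply Leibniz. Where the
    subtraction is truncated, the factor [l j] vanishes. *)
Lemma deriv_linsub V k l :
  (linsub V 'X_[l])^`M(k) =
  \sum_j (V k j *+ l j) *: linsub V 'X_[l - U_(j)].
Proof.
elim: {l}(mdeg l) {-2}l (erefl (mdeg l)) => [|N IH] l E.
  move/eqP: E; rewrite mdeg_eq0 => /eqP ->.
  rewrite mpolyX0 rmorph1 -mpolyC1 mderivC big1 // => j _.
  by rewrite mnm0E mulr0n scale0r.
have [i li] : exists i, l i != 0%N by apply: mdeg_gt0_ex; rewrite E.
pose l' := (l - U_(i))%MM; have El : l = (U_(i) + l')%MM by rewrite addmC mnm_subK.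
have E' : mdeg l' = N by apply/succn_inj; rewrite mdeg_subS.
rewrite El mpolyXD rmorphM /= mderivM (IH l') // linsubXU deriv_lform mul_mpolyC !mxE.
rewrite mulr_sumr [RHS](bigD1 i) //= mnmDE mnm1E eqxx add1n mulrS scalerDl -addrA.
congr (_ *: _ + _); first by rewrite addmC addmK.
rewrite [LHS](bigD1 i) //=; congr (_ + _).
  rewrite -scalerAr; have [->|l'i] := eqVneq (l' i) 0%N.
    by rewrite mulr0n !scale0r.
  congr (_ *: _); rewrite -linsubXU -rmorphM -mpolyXD; congr (linsub V 'X_[_]).
  by rewrite addmC mnm_subK // addmC addmK.
apply: eq_bigr => j ji; rewrite mnmDE mnm1E eq_sym (negPf ji) add0n.
have [->|l'j] := eqVneq (l' j) 0%N; first by rewrite mulr0n !scale0r mulr0.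
rewrite -scalerAr; congr (_ *: _); rewrite -linsubXU -rmorphM -mpolyXD.
by congr (linsub V 'X_[_]); rewrite -{2}(mnm_subK l'j) addmA addmK.
Qed.

(* [n! <x^n> (V x)^l] satisfies the same recursion in [n] on both sides. *)
Lemma linsub_coef_adj V n l :
  (linsub V 'X_[l])@_n *+ mfact n = (linsub V^T 'X_[n])@_l *+ mfact l.
Proof.
elim: {n}(mdeg n) {-2}n (erefl (mdeg n)) l => [|N IH] n E l.
  move/eqP: E; rewrite mdeg_eq0 => /eqP ->.
  rewrite mpolyX0 rmorph1 mcoeff1; have [->|l0] := eqVneq l 0%MM.
    by rewrite mpolyX0 rmorph1 mcoeff1 eqxx.
  by rewrite linsub_coef0 ?mul0rn // mdeg0 mdeg_eq0.
have [k nk] : exists k, n k != 0%N by apply: mdeg_gt0_ex; rewrite E.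
pose n' := (n - U_(k))%MM; have En : n = (n' + U_(k))%MM by rewrite mnm_subK.
have E' : mdeg n' = N by apply/succn_inj; rewrite mdeg_subS.
(* Differentiating in [k] lowers [n] to [n'] and absorbs the factor [n k] of the multi-index
   factorial. *)
have -> : (linsub V 'X_[l])@_n *+ mfact n =
          ((linsub V 'X_[l])^`M(k))@_n' *+ mfact n'.
  by rewrite mcoeff_deriv -mulrnA En mfactD.
rewrite deriv_linsub raddf_sum -sumrMnl.
rewrite En addmC mpolyXD rmorphM /= linsubXU /lform mulr_suml raddf_sum -sumrMnl.
apply: eq_bigr => j _ /=.
rewrite -scalerAl !mcoeffZ mcoeff_mulX !mxE.
have [->|lj] := eqVneq (l j) 0%N; first by rewrite mulr0n mul0r mulr0 !mul0rn.
rewrite -mulrnAr IH //; have -> : mfact l = (l j * mfact (l - U_(j))%MM)%N.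
  by rewrite -{1}(mnm_subK lj) mfactD mnmBE mnm1E eqxx subn1 prednK // lt0n.
by rewrite mulrnAl -!mulrnAr -mulrnA mulnC.
Qed.

(** The Fischer pairing restricted to degrees below [D]. It is bilinear: complex conjugation is
    supplied in the second argument when norms are computed, and the adjoint of a substitution is
    given by the transpose. *)
Definition fischer D P Q : K :=
  \sum_(n : 'X_{1..m < D}) (P@_n * Q@_n) *+ mfact n.

Lemma fischer_linsub D V P Q : (msize P <= D)%N -> (msize Q <= D)%N ->
  fischer D (linsub V P) Q = fischer D P (linsub V^T Q).
Proof.
move=> PD QD; rewrite /fischer.
transitivity (\sum_(n : 'X_{1..m < D}) \sum_(l : 'X_{1..m < D})
   P@_l * Q@_n * ((linsub V 'X_[l])@_n *+ mfact n)).
  apply: eq_bigr => n _; rewrite {1}(mpolywE PD) (linear_sum (linsub V)) /= raddf_sum /=.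
  rewrite mulr_suml -sumrMnl; apply: eq_bigr => l _.
  by rewrite linearZ mcoeffZ /= -!mulrnAr; ring.
rewrite exchange_big; apply: eq_bigr => l _ /=.
rewrite {2}(mpolywE QD) (linear_sum (linsub V^T)) /= raddf_sum /= mulr_sumr -sumrMnl.
apply: eq_bigr => n _.
by rewrite linearZ mcoeffZ /= linsub_coef_adj -!mulrnAr; ring.
Qed.

End Substitution.

(** * Second quantization of a unitary matrix *)

Lemma map_lform (K : fieldType) m (f : {rmorphism K -> K}) (w : 'rV[K]_m) :
  map_mpoly f (lform w) = lform (map_mx f w).
Proof.
rewrite /lform rmorph_sum; apply: eq_bigr => j _ /=.
by rewrite map_mpolyZ map_mpolyX mxE.
Qed.

Lemma map_linsub (K : fieldType) m (f : {rmorphism K -> K}) (V : 'M[K]_m) P :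
  map_mpoly f (linsub V P) = linsub (map_mx f V) (map_mpoly f P).
Proof.
pose g1 : {rmorphism {mpoly K[m]} -> {mpoly K[m]}} := map_mpoly f \o linsub V.
pose g2 : {rmorphism {mpoly K[m]} -> {mpoly K[m]}} :=
  linsub (map_mx f V) \o map_mpoly f.
apply: (@eq_rmorph_mpoly _ _ _ g1 g2) => [c|j] /=.
  by rewrite /linsub comp_mpolyC !map_mpolyC ?comp_mpolyC ?rmorph0.
rewrite map_mpolyX !linsubXU map_lform; congr lform.
by apply/rowP => k; rewrite !mxE.
Qed.

(** Gram-Schmidt applied to the matrix whose rows all equal [v] yields a unitary matrix whose first
    row spans the line of [v]; its transpose is the answer. *)
Lemma unitary_first_col (K : numClosedFieldType) m (v : 'rV[K]_m.+1) : v != 0 ->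
  exists V : 'M[K]_m.+1, exists c, [/\ V \is unitarymx, c != 0
    & (col ord0 V)^T = c *: v].
Proof.
move=> v0; pose A : 'M[K]_m.+1 := \matrix_(i < m.+1) v.

have [c Ec] : exists c, v = c *: row ord0 (schmidt A).
  apply/sub_rVP; have <- : row ord0 A = v by rewrite rowK.
  apply: (submx_trans (row_schmidt_sub A ord0)).
  apply/sumsmx_subP => k; rewrite leqn0 => /eqP k0.
  by have -> : k = ord0; [apply: val_inj | rewrite genmxE].
exists (schmidt A)^T, c^-1; split.
- by rewrite trmx_unitary schmidt_unitarymx.
- by rewrite invr_eq0; apply: contraNneq v0 => c0; rewrite Ec c0 scale0r.
have c0 : c != 0 by apply: contraNneq v0 => c0; rewrite Ec c0 scale0r.
by rewrite [in RHS]Ec scalerA mulVf // scale1r -tr_row trmxK.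
Qed.

Section SecondQuantization.
Variables (R : realType) (m : nat).
Local Notation C := R[i].
Implicit Types (phi chi psi : fock R m) (P Q : {mpoly C[m]}) (n l : 'X_{1..m}).
Implicit Types (V W : 'M[C]_m).

Definition trunc D phi : {mpoly C[m]} :=
  \sum_(l : 'X_{1..m < D}) (phi l / fnorm R l) *: 'X_[l].

Lemma trunc_coef D phi l : (mdeg l < D)%N ->
  fnorm R l * (trunc D phi)@_l = phi l.
Proof.
move=> lD; rewrite (mcoeff_mpoly (fun l => phi l / fnorm R l) lD).
by rewrite mulrC divfK // fnorm_neq0.
Qed.

Lemma msize_trunc D phi : (msize (trunc D phi) <= D)%N.
Proof.
apply: (leq_trans (msize_sum _ _ _)); apply/bigmax_leqP => l _.
by apply: (leq_trans (msizeZ_le _ _)); rewrite msizeX bmdeg.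
Qed.

#[local] Opaque trunc fnorm linsub.

(* The matrix elements of [quantize V] vanish between different photon numbers,
   so each amplitude is a finite sum, for an arbitrary [phi]. *)
Definition quantize V phi : fock R m :=
  fun n => fnorm R n * (linsub V (trunc (mdeg n).+1 phi))@_n.

(** Any polynomial that agrees with [phi] at the photon number of [n] may replace the truncation in
    the definition. *)
Lemma quantizeE V phi Q n :
  (forall l, mdeg l = mdeg n -> phi l = fnorm R l * Q@_l) ->
  quantize V phi n = fnorm R n * (linsub V Q)@_n.
Proof.
move=> H; rewrite /quantize; apply: (congr1 ( *%R (fnorm R n))).
apply: eq_linsub_coef => l ln.
by apply: (mulfI (fnorm_neq0 R l)); rewrite trunc_coef ?ln // H.
Qed.

Lemma quantize_trunc V phi D n : (mdeg n < D)%N ->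
  quantize V phi n = fnorm R n * (linsub V (trunc D phi))@_n.
Proof. by move=> nD; apply: quantizeE => l ln; rewrite trunc_coef // ln. Qed.

Lemma quantize_linear V (c : C) phi chi :
  quantize V (fun n => c * phi n + chi n) =
  (fun n => c * quantize V phi n + quantize V chi n).
Proof.
apply: funext => n.
rewrite (@quantizeE _ _ (c *: trunc (mdeg n).+1 phi + trunc (mdeg n).+1 chi)).
  by rewrite (linearP (linsub V)) mcoeffD mcoeffZ mulrDr mulrCA.
move=> l ln; rewrite -[in LHS](@trunc_coef (mdeg n).+1 phi l) ?ln //.
rewrite -[in LHS](@trunc_coef (mdeg n).+1 chi l) ?ln //.
by rewrite mcoeffD mcoeffZ mulrDr mulrCA.
Qed.

Lemma quantizeM V W phi : quantize V (quantize W phi) = quantize (V *m W) phi.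
Proof.
apply: funext => n.
rewrite (@quantizeE _ _ (linsub W (trunc (mdeg n).+1 phi))).
  by rewrite linsubM.
by move=> l ln; apply: quantize_trunc; rewrite ln.
Qed.

Lemma quantize1 phi : quantize 1%:M phi = phi.
Proof. by apply: funext => n; rewrite /quantize linsub1 trunc_coef. Qed.

Lemma quantize_vacuum V : quantize V (@vacuum R m) = @vacuum R m.
Proof.
rewrite -fock_of1; apply: funext => n.
by rewrite (@quantizeE _ _ 1) // rmorph1.
Qed.

Lemma coef_lformM (w : 'rV[C]_m) P n :
  (lform w * P)@_n = \sum_k w 0 k * ('X_k * P)@_n.
Proof.
rewrite /lform mulr_suml raddf_sum; apply: eq_bigr => k _ /=.
by rewrite -scalerAl mcoeffZ.
Qed.

Lemma quantize_create V j phi :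
  quantize V (create j phi) =
  (fun n => \sum_(k < m) V k j * create k (quantize V phi) n).
Proof.
apply: funext => n; pose P := trunc (mdeg n).+1 phi.
rewrite (@quantizeE _ _ ('X_j * P)); last first.
  move=> l ln; apply: create_coef => l' El'.
  by rewrite trunc_coef // -ln -El' ltnS leqW.
rewrite rmorphM /= linsubXU coef_lformM mulr_sumr; apply: eq_bigr => k _.
rewrite !mxE (@create_coef _ _ _ _ (linsub V P)); first by ring.
by move=> l El; apply: quantize_trunc; rewrite -El ltnS leqW.
Qed.

Lemma sum_normc_fischer D P :
  (\sum_(n : 'X_{1..m < D}) Normc.normc (fnorm R n * P@_n) ^+ 2)%:C =
  fischer D P (map_mpoly Num.conj P).
Proof.
rewrite rmorph_sum; apply: eq_bigr => n _ /=.
rewrite normc_sqr rmorphM /= fnorm_conj mcoeff_map_mpoly -mulr_natl -fnorm_sqr.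
by ring.
Qed.

(** Squared norms are Fischer pairings of a polynomial with its conjugate. Moving the substitution
    to the other side leaves [V^T] times the conjugate of [V], which is the identity. *)
Lemma normsq_quantize V phi : V \is unitarymx ->
  normsq (quantize V phi) = normsq phi.
Proof.
move=> uV; apply: eq_normsq => D; apply: complexI; pose P := trunc D phi.
transitivity (fischer D (linsub V P) (map_mpoly Num.conj (linsub V P))).
  rewrite -sum_normc_fischer; apply: (congr1 (real_complex R)).
  by apply: eq_bigr => n _; rewrite (@quantize_trunc _ _ D) // bmdeg.
transitivity (fischer D P (map_mpoly Num.conj P)); last first.
  rewrite -sum_normc_fischer; apply: (congr1 (real_complex R)).
  by apply: eq_bigr => n _; rewrite trunc_coef // bmdeg.
have PD : (msize P <= D)%N by apply: msize_trunc.
rewrite map_linsub.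
have HD Q : (msize Q <= D)%N -> (msize (linsub (map_mx Num.conj V) Q) <= D)%N.
  move=> QD; rewrite [Q]mpolyE (linear_sum (linsub _)).
  apply: (leq_trans (msize_sum _ _ _)); apply/bigmax_leqP_seq => l lQ _.
  rewrite linearZ; apply: (leq_trans (msizeZ_le _ _)).
  apply: (@leq_trans (mdeg l).+1); last first.
    by apply: leq_trans QD; apply: msize_mdeg_lt.
  apply/bigmax_leqP_seq => n nL _; rewrite ltnS leq_eqVlt.
  by rewrite (dhomog_mf (linsub_homog _ _) nL) eqxx.
have QD : (msize (map_mpoly Num.conj P) <= D)%N.
  apply: leq_trans PD; apply/bigmax_leqP_seq => n; rewrite mcoeff_msupp.
  rewrite mcoeff_map_mpoly => nP _; apply: msize_mdeg_lt.
  by rewrite mcoeff_msupp; apply: contraNneq nP => -> /=; rewrite conjC0.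
rewrite (fischer_linsub _ PD (HD _ QD)) linsubM.
suff -> : V^T *m map_mx Num.conj V = 1%:M by rewrite linsub1.
have := uV; rewrite -trmx_unitary => /unitarymxP.
by rewrite trmxK.
Qed.

Lemma interferometer_quantize V : V \is unitarymx ->
  interferometer V (quantize V).
Proof.
move=> uV; split => //; last by move=> j phi _ _; apply: quantize_create.
  split; [by move=> *; apply: quantize_linear
         | by move=> *; apply: normsq_quantize |].
(* Surjectivity: the adjoint matrix provides the preimage. *)
move=> chi chi2; exists (quantize (V ^t*)%sesqui chi).
  rewrite /l2 normsq_quantize //; have := uV; by rewrite -trmxC_unitary.
by rewrite quantizeM (unitarymxP uV) quantize1.
exact: quantize_vacuum.
Qed.

(** The action on core states is forced: the vacuum is fixed, the intertwining relation determines
    the monomials by induction on the degree, and linearity does the rest. *)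
Lemma interferometer_fock_of V T P : interferometer V T ->
  T (fock_of P) = fock_of (linsub V P).
Proof.
move=> [_ [linT _ _] vacT crT].
have T0 : T (fock_of 0) = fock_of 0.
  (* Linearity is given for combinations [c * phi + chi], so zero is written as one. *)
  have -> : 0 = (-1) *: 1 + 1 :> {mpoly C[m]} by rewrite scaleN1r addNr.
  by rewrite fock_ofZD linT ?fock_of1 ?vacT // -fock_of1; apply: l2_fock_of.
have TX l : T (fock_of 'X_[l]) = fock_of (linsub V 'X_[l]).
  elim: {l}(mdeg l) {-2}l (erefl (mdeg l)) => [|N IH] l E.
    move/eqP: E; rewrite mdeg_eq0 => /eqP ->.
    by rewrite mpolyX0 rmorph1 fock_of1.
  have [j lj] : exists i, l i != 0%N by apply: mdeg_gt0_ex; rewrite E.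
  rewrite -(mnm_subK lj) addmC mpolyXD rmorphM /= -create_fock_of.
  rewrite crT ?create_fock_of; try exact: l2_fock_of.
  rewrite IH; last by apply/succn_inj; rewrite mdeg_subS.
  apply: funext => n; rewrite /fock_of linsubXU coef_lformM mulr_sumr.
  apply: eq_bigr => k _; rewrite !mxE.
  have := congr1 (fun f => f n) (create_fock_of k (linsub V 'X_[l - U_(j)])).
  by rewrite /fock_of => ->; ring.
elim/mpolyind: P => [|c l P _ _ IH]; first by rewrite T0 rmorph0.
rewrite fock_ofZD linT ?TX ?IH; try exact: l2_fock_of.
by rewrite -fock_ofZD linearP.
Qed.

End SecondQuantization.

(** * Reachable states are products of linear forms *)

Section Reachable.
Variables (R : realType) (m : nat).
Local Notation C := R[i].

(** To append the form [v], prepare the others rotated backwards, add a photon in mode [0], and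
    apply a unitary sending that mode to the direction of [v]. *)
Lemma reachable_forms (s : seq 'rV[C]_m.+1) : all (fun v => v != 0) s ->
  exists2 c : C, c != 0 &
    reachable (size s) (size s) (fock_of (c *: \prod_(v <- s) lform v)).
Proof.
elim: {s}(size s) {-2}s (erefl (size s)) => [|N IH] [|v s] //= E.
  move=> _; exists 1; rewrite ?oner_eq0 // big_nil scale1r fock_of1.
  exact: reachable_vacuum.
move=> /andP [v0 s0]; case: E => E.
have [V [c [uV c0 Ec]]] := unitary_first_col v0.
have uVt : V^T \in unitmx by rewrite unitmx_tr unitarymx_unit.
(* These forms become those of [s] again under the last interferometer. *)
pose s' := [seq w *m invmx V^T | w <- s].
have s'0 : all (fun v => v != 0) s'.
  rewrite all_map; apply: sub_all s0 => w /=; apply: contraNneq => Ew.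
  by rewrite -[w](mulmxKV uVt) Ew mul0mx.
have [|c' c'0 H] := IH s' _ s'0; first by rewrite size_map.
move: H; rewrite size_map E => H.
exists (c' * c); first by rewrite mulf_neq0.
have := reachable_interferometer (reachable_create ord0 H)
  (interferometer_quantize uV).
rewrite create_fock_of (interferometer_fock_of _ (interferometer_quantize uV)).
congr reachable; congr fock_of.
rewrite rmorphM /= linsubXU Ec !linearZ /= -scalerAr -scalerAl scalerA.
congr (_ *: _); rewrite big_cons rmorph_prod big_map; congr (_ * _).
by apply: eq_bigr => w _ /=; rewrite linsub_lform mulmxKV.
Qed.

(** An addition multiplies by a variable and an interferometer substitutes linearly; only the former
    changes the number of factors. *)
Lemma reachable_inv p q (phi : fock R m) : reachable p q phi ->
  exists2 s : seq 'rV[C]_m, size s = p & phi = fock_of (\prod_(v <- s) lform v).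
Proof.
elim=> {p q phi} [|p q phi j _ [s <- ->]|p q phi V T _ [s <- ->] HT].
- by exists [::]; rewrite // big_nil fock_of1.
- by exists (delta_mx 0 j :: s); rewrite // big_cons create_fock_of lform_delta.
- exists [seq w *m V^T | w <- s]; first by rewrite size_map.
  rewrite (interferometer_fock_of _ HT) rmorph_prod big_map.
  by congr fock_of; apply: eq_bigr => w _ /=; rewrite linsub_lform.
Qed.

End Reachable.

(** * Single-ancilla protocols *)

Section Insert.
Variable m : nat.
Implicit Types (n : 'X_{1..m}) (j : 'I_m.+1).

Lemma insert_mnm_id j k n : insert_mnm j k n j = k.
Proof. by rewrite mnmE unlift_none. Qed.

Lemma insert_mnm_lift j k n i : insert_mnm j k n (lift j i) = n i.
Proof. by rewrite mnmE liftK. Qed.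

Lemma insert_mnm_eq j k n (l : 'X_{1..m.+1}) :
  l j = k -> (forall i, l (lift j i) = n i) -> l = insert_mnm j k n.
Proof.
move=> lk ln; apply/mnmP => i; case: (unliftP j i) => [i'|] ->.
  by rewrite ln insert_mnm_lift.
by rewrite lk insert_mnm_id.
Qed.

Lemma big_ord_lift (T : Type) (idx : T) (op : Monoid.com_law idx) j
    (F : 'I_m.+1 -> T) :
  \big[op/idx]_(i < m.+1) F i = op (F j) (\big[op/idx]_(i < m) F (lift j i)).
Proof.
rewrite (bigD1 j) //=; congr (op _ _).
rewrite (reindex_omap (lift j) (unlift j)) => [|i ij] /=.
  apply: eq_bigl => i; rewrite liftK eqxx andbT.
  by rewrite eq_sym neq_lift.
by case: unliftP ij => [i' ->|->] //=; rewrite eqxx.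
Qed.

Lemma mfact_insert j k n : mfact (insert_mnm j k n) = (k`! * mfact n)%N.
Proof.
rewrite /mfact (big_ord_lift _ j) /= insert_mnm_id; congr (_ * _)%N.
by apply: eq_bigr => i _; rewrite insert_mnm_lift.
Qed.

Lemma fnorm_insert (R : realType) j k n :
  fnorm R (insert_mnm j k n) = sqrtC (k`!)%:R * fnorm R n.
Proof. by rewrite /fnorm mfact_insert natrM sqrtCM // nnegrE ler0n. Qed.

Lemma widen_lift_max (i : 'I_m) : widen_ord (leqnSn m) i = lift ord_max i.
Proof. by apply: val_inj; rewrite /= /bump leqNgt ltn_ord. Qed.

End Insert.

(** * Separating the ancilla variable *)

Section LastVariable.
Variables (K : fieldType) (m : nat).
Implicit Types (P : {mpoly K[m.+1]}) (w : 'rV[K]_m.+1).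

(** The link with measurement: up to normalisation, projecting the last mode onto [k] photons
    extracts the coefficient of ['X^k]. *)
Lemma muni_coef P k n : (muni P)`_k@_n = P@_(insert_mnm ord_max k n).
Proof.
rewrite muniE coef_sum raddf_sum /= [in RHS](mpolyE P) raddf_sum /=.
apply: eq_bigr => l _; rewrite coefZ coefXn mcoeffZ mcoeffX.
have [El|nl] := eqVneq l (insert_mnm ord_max k n).
  rewrite El insert_mnm_id eqxx mulr1 mcoeffZ mcoeffX.
  suff -> : [multinom insert_mnm ord_max k n (widen_ord (leqnSn m) i) | i < m] = n.
    by rewrite eqxx.
  by apply/mnmP => i; rewrite mnmE widen_lift_max insert_mnm_lift.
rewrite mulr0; case: eqP => [Ek|_]; last by rewrite mulr0 mcoeff0.
rewrite mulr1 mcoeffZ mcoeffX; case: eqP => [En|_]; last by rewrite mulr0.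
case/eqP: nl; apply: insert_mnm_eq => // i.
by rewrite -En mnmE widen_lift_max.
Qed.

Lemma muni_lform w :
  muni (lform w) =
  (lform (\row_i w 0 (lift ord_max i)))%:P + (w 0 ord_max)%:MP *: 'X.
Proof.
apply/polyP => k; apply/mpolyP => n; rewrite muni_coef.
rewrite coefD coefC coefZ coefX mcoeffD.
rewrite /lform raddf_sum (big_ord_lift _ ord_max) /= addrC.
have EX (l1 l2 : 'X_{1..m.+1}) : 'X_[l1]@_l2 = (l1 == l2)%:R :> K by exact: mcoeffX.
congr (_ + _).
  case: (k =P 0%N) => [->|/eqP k0].
    rewrite raddf_sum; apply: eq_bigr => i _ /=.
    rewrite !mcoeffZ !mcoeffX mxE; congr (_ * (nat_of_bool _)%:R).
    apply/eqP/eqP => [E|<-].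
      apply/mnmP => i'; move/mnmP: E => /(_ (lift ord_max i')).
      by rewrite !mnm1E insert_mnm_lift (inj_eq (@lift_inj _ _)).
    apply: insert_mnm_eq => [|i']; first by rewrite mnm1E eq_sym (negPf (neq_lift _ _)).
    by rewrite !mnm1E (inj_eq (@lift_inj _ _)).
  rewrite mcoeff0 big1 // => i _; rewrite mcoeffZ mcoeffX.
  case: eqP => [E|_]; last by rewrite mulr0.
  move/mnmP: E => /(_ ord_max); rewrite insert_mnm_id mnm1E eq_sym.
  by rewrite (negPf (neq_lift _ _)) => E; rewrite -E in k0.
rewrite mcoeffZ mcoeffX mulr_natr.
have [El|nl] := eqVneq U_(ord_max)%MM (insert_mnm ord_max k n).
  have -> : k = 1%N.
    by move/mnmP: El => /(_ ord_max); rewrite insert_mnm_id mnm1E eqxx.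
  have -> : n = 0%MM.
    apply/mnmP => i; move/mnmP: El => /(_ (lift ord_max i)).
    by rewrite insert_mnm_lift mnm1E (negPf (neq_lift _ _)) mnm0E.
  by rewrite eqxx mulr1 mcoeffC eqxx mulr1.
rewrite mulr0; case: eqP => [k1|_]; last by rewrite mulr0n mcoeff0.
rewrite mulr1n mcoeffC; case: eqP => [n0|_]; last by rewrite mulr0.
case/eqP: nl; apply: insert_mnm_eq => [|i]; first by rewrite mnm1E eqxx k1.
by rewrite mnm1E (negPf (neq_lift _ _)) n0 mnm0E.
Qed.

End LastVariable.

Lemma esym_linZ (K : fieldType) N M d a (U : 'M[K]_(N, M)) :
  esym_lin d (a *: U) = a ^+ d *: esym_lin d U.
Proof.
rewrite !esym_linE scaler_sumr; apply: eq_bigr => J /eqP <-.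
rewrite -prodr_const -scaler_prod; apply: eq_bigr => i _.
by rewrite linearZ /= linearZ.
Qed.

Lemma esym_lin1 (K : fieldType) M (w : 'M[K]_(1, M)) : esym_lin 1 w = lform w.
Proof.
rewrite esym_lin_coef big_ord1 coefD coefC coefZ coefX /= add0r mulr1.
by congr lform; apply/rowP => j; rewrite mxE.
Qed.

(** Divide each factor by [t i] and reverse the coefficients. *)
Lemma coef_prod_lform (K : fieldType) N M k (t : 'I_N -> K) (r : 'I_N -> 'rV[K]_M) :
  (forall i, t i != 0) -> (k <= N)%N ->
  (\prod_i ((lform (r i))%:P + (t i)%:MP *: 'X))`_k =
  (\prod_i t i) *: esym_lin (N - k) (\matrix_i ((t i)^-1 *: r i)).
Proof.
move=> t0 kN; rewrite coef_prod_linearC card_ord // coef_prod_linear esym_linE.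
rewrite scaler_sumr; apply: eq_bigr => J _.
rewrite [X in _ *: X]big_mkcond -scaler_prod; apply: eq_bigr => i _.
case: ifP => _; last by rewrite -mul_mpolyC mulr1.
by rewrite rowK linearZ /= scalerA divff // scale1r.
Qed.

(** * Construction and lower bound with one ancilla *)

Section Protocol.
Variables (R : realType) (M : nat).
Local Notation C := R[i].

Lemma project_fock_of (P : {mpoly C[M.+1]}) k n :
  project ord_max k (fock_of P) n = sqrtC (k`!)%:R * fock_of (muni P)`_k n.
Proof. by rewrite /project /fock_of fnorm_insert muni_coef mulrA. Qed.

Lemma sqrt_fact_neq0 k : sqrtC (k`!)%:R != 0 :> C.
Proof. by rewrite sqrtC_eq0 pnatr_eq0 -lt0n fact_gt0. Qed.

Lemma prepare_esym_lin N d (U : 'M[C]_(N, M)) : (d <= N)%N ->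
  exists (phi : fock R M.+1) (c : C), [/\ reachable N N phi, c != 0 &
    forall n, project ord_max (N - d) phi n = c * fock_of (esym_lin d U) n].
Proof.
move=> dN.
pose v (i : 'I_N) : 'rV[C]_M.+1 :=
  \row_j (if unlift ord_max j is Some j' then U i j' else 1).
(* The ancilla coordinate [1] keeps the form nonzero even if the row of [U] vanishes. *)
have v0 i : v i != 0.
  apply/eqP => /rowP /(_ ord_max); rewrite !mxE unlift_none => /eqP.
  by rewrite oner_eq0.
pose s := [seq v i | i <- enum 'I_N].
have ss : size s = N by rewrite size_map size_enum_ord.
have [|c c0] := @reachable_forms R M s.
  by apply/allP => w /mapP [i _ ->].
rewrite ss => H; exists (fock_of (c *: \prod_(v <- s) lform v)).
exists (sqrtC ((N - d)`!)%:R * c); split => //.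
  by rewrite mulf_neq0 // sqrt_fact_neq0.
move=> n; rewrite project_fock_of -mulrA; congr (_ * _).
rewrite muniZ coefZ rmorph_prod big_map big_enum /=.
under eq_bigr do rewrite muni_lform.
rewrite /fock_of mul_mpolyC mcoeffZ mulrCA; congr (_ * (_ * _)).
congr (mcoeff n); rewrite esym_lin_coef_rev //.
apply: (congr1 (fun p : {poly {mpoly C[M]}} => p`_(N - d))).
apply: eq_bigr => i _; rewrite mxE unlift_none mpolyC1; congr ((lform _)%:P + _).
by apply/rowP => j; rewrite !mxE liftK.
Qed.

Lemma stellar_homog_single_ancilla (psi : fock R M) d N (U : 'M[C]_(N, M)) :
  core_state psi -> stellar psi != 0 -> stellar psi = esym_lin d U ->
  single_ancilla N N (N - d) psi.
Proof.
move=> cs s0 E; have [dN|Nd] := leqP d N; last first.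
  by rewrite E esym_lin_gt ?eqxx in s0.
have [phi [c [rphi c0 H]]] := prepare_esym_lin U dN.
by exists phi => //; exists c => // n; rewrite H -E stellarK.
Qed.

Lemma mpoly_unitE (K : fieldType) m (P : {mpoly K[m]}) :
  (P \is a GRing.unit) = (P == (P@_0%MM)%:MP) && (P@_0%MM != 0).
Proof. by rewrite -unitfE. Qed.

Lemma single_ancilla_bound (psi : fock R M) d N p q k :
  core_state psi -> stellar psi \is d.-homog ->
  mpoly_irreducible (stellar psi) ->
  (forall (N' : nat) (U : 'M[C]_(N', M)),
     stellar psi = esym_lin d U -> (N <= N')%N) ->
  (0 < d)%N -> single_ancilla p q k psi -> (N <= p)%N.
Proof.
move=> cs hom [P0 _ irr] minN d0 [phi /reachable_inv [s ss ->] [c c0 Hc]].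
set P := stellar psi in hom P0 irr minN.
set Q := \prod_(v <- s) lform v in Hc.
have [e e0 EP] : exists2 e, e != 0 & P = e *: (muni Q)`_k.
  exists (c^-1 * sqrtC (k`!)%:R); first by rewrite mulf_neq0 ?invr_eq0 ?sqrt_fact_neq0.
  apply/mpolyP => n; apply: (mulfI (fnorm_neq0 R n)).
  have := Hc n; rewrite project_fock_of -[in RHS](stellarK cs) -/P /fock_of => H.
  rewrite mcoeffZ -[LHS](mulKf c0) -H; ring.
pose t (i : 'I_p) := (nth 0 s i) 0 ord_max.
pose r (i : 'I_p) : 'rV[C]_M := \row_j (nth 0 s i) 0 (lift ord_max j).
have EQ : muni Q = \prod_i ((lform (r i))%:P + (t i)%:MP *: 'X).
  rewrite rmorph_prod (big_nth 0) ss big_mkord; apply: eq_bigr => i _ /=.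
  by rewrite muni_lform.
(* If some form does not involve the ancilla, it factors out of the coefficient of ['X^k]. *)
have [/existsP [i /eqP ti0]|] := boolP [exists i, t i == 0].
  rewrite EQ (bigD1 i) //= ti0 mpolyC0 scale0r addr0 coefCM scalerAl in EP.
  set B := _`_k in EP.
  (* A linear form has no constant term and so is not a unit; the cofactor [B] must then be
     constant, and [P] is linear. *)
  have [] := irr _ _ EP; rewrite mpoly_unitE.
    have /dhomog_nemf_coeff -> : e *: lform (r i) \is 1.-homog.
      by apply: rpredZ; apply: lform_homog.
      by rewrite eqxx andbF.
    by rewrite /= mdeg0.
  move=> /andP [/eqP EB _].
  have EP' : P = lform ((e * B@_0%MM) *: r i).
    rewrite EP [in LHS]EB linearZ /= mulrC mul_mpolyC scalerA.
    by rewrite [_ * e]mulrC.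
  have d1 : d = 1%N.
    by apply: (dhomog_uniq P0 hom); rewrite EP'; apply: lform_homog.
  (* A linear [P] needs one row, and the existence of the index [i] shows that [p] is positive. *)
  apply: (@leq_trans 1%N); last by rewrite (leq_ltn_trans _ (ltn_ord i)).
  apply: (minN 1%N ((e * B@_0%MM) *: r i)).
  by rewrite EP' d1 esym_lin1.
rewrite negb_exists => /forallP t0.
have kp : (k <= p)%N.
  rewrite leqNgt; apply: contra P0 => pk.
  rewrite EP EQ coef_prod_linear big1 ?scaler0 // => J /eqP EJ.
  by have := max_card (mem J); rewrite card_ord EJ leqNgt pk.
pose U : 'M[C]_(p, M) := \matrix_i ((t i)^-1 *: r i).
have EU : (muni Q)`_k = (\prod_i t i) *: esym_lin (p - k) U.
  by rewrite EQ coef_prod_lform.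
have T0 : \prod_i t i != 0 by apply/prodf_neq0.
have dE : d = (p - k)%N.
  apply: (dhomog_uniq P0 hom); rewrite EP EU.
  by do 2 apply: rpredZ; apply: esym_lin_homog.
(* By homogeneity of degree [d], a [d]-th root absorbs the scalar into the matrix. *)
apply: (minN p (d.-root (e * \prod_i t i) *: U)).
by rewrite (esym_linZ d _ U) (rootCK d0) EP EU scalerA {1}dE.
Qed.

End Protocol.

(** * Displacements *)

Section GeometricBounds.
Variable R : realType.
Implicit Types (D x y : R) (k K : nat).
Local Notation C := R[i].
Local Notation normc := (@Normc.normc R).
Local Notation h := (2^-1 : R).

Lemma halfS k : h ^+ k = 2 * h ^+ k.+1.
Proof. by rewrite exprS mulrA divff ?mul1r // pnatr_eq0. Qed.

Lemma half_exp_gt0 k : 0 < h ^+ k.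
Proof. by rewrite exprn_gt0 // invr_gt0 ltr0n. Qed.

Lemma half_small D x : 0 <= x -> (forall K, x <= D * h ^+ K) -> x = 0.
Proof.
move=> x0 H; apply/eqP; rewrite eq_le x0 andbT leNgt; apply/negP => xp.
have D0 : 0 <= D by have := H 0%N; rewrite expr0 mulr1; apply: le_trans.
pose K := Num.truncn (D / x).
have HK : D < K.+1%:R * x by rewrite -ltr_pdivrMr // truncnS_gt.
have := H K.+1; rewrite exprVn leNgt => /negP; apply.
rewrite ltr_pdivrMr ?exprn_gt0 // mulrC; apply: (lt_le_trans HK).
rewrite ler_pM2r // -natrX ler_nat; exact: ltnW (ltn_expl _ _).
Qed.

(** Nested intervals: around the partial sum [S K], the interval of radius [e K] contains the next
    one; the limit is the supremum of the left ends. *)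
Lemma real_geometric_limit (x : nat -> R) D :
  (forall k, `|x k| <= D * h ^+ k) ->
  exists l, forall K, `|\sum_(k < K) x k - l| <= 2 * D * h ^+ K.
Proof.
move=> H; pose S K := \sum_(k < K) x k; pose e K := 2 * D * h ^+ K.
have stepS K : `|S K.+1 - S K| <= e K - e K.+1.
  rewrite /S big_ord_recr /= addrAC subrr add0r; apply: (le_trans (H K)).
  by rewrite /e (halfS K); lra.
have mono j K : S K - e K <= S (K + j)%N - e (K + j)%N /\
                S (K + j)%N + e (K + j)%N <= S K + e K.
  elim: j => [|j [IH1 IH2]]; first by rewrite addn0.
  rewrite addnS; have := stepS (K + j)%N; rewrite ler_norml => /andP [H1 H2].
  by split; lra.
have e0 K : 0 <= e K.
  have D0 : 0 <= D by have := H 0%N; rewrite expr0 mulr1; apply: le_trans.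
  by rewrite /e !mulr_ge0 // ltW // half_exp_gt0.
pose A := [set S K - e K | K in [set: nat]].
have ubA K : ubound A (S K + e K).
  move=> _ [K' _ <-]; have [KK|/ltnW KK] := leqP K K'.
    have := mono (K' - K)%N K; rewrite subnKC // => -[_].
    by have := e0 K'; lra.
  have := mono (K - K')%N K'; rewrite subnKC // => -[+ _].
  by have := e0 K; lra.
have A0 : A !=set0 by exists (S 0%N - e 0%N), 0%N.
exists (sup A) => K; rewrite ler_distl -/(S K) -/(e K).
have H1 : sup A <= S K + e K by apply: ge_sup => //; apply: ubA.
have H2 : S K - e K <= sup A.
  by apply: sup_upper_bound; [split => //; exists (S 0%N + e 0%N); apply: ubA | exists K].
by apply/andP; split; lra.
Qed.

Lemma normcD (x y : C) : normc (x + y) <= normc x + normc y.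
Proof. exact: le_normcD. Qed.

Lemma normc_ge0 (x : C) : 0 <= normc x.
Proof. by case: x => a b; apply: sqrtr_ge0. Qed.

Lemma normc_real x : normc x%:C = `|x|.
Proof. by rewrite /= expr0n addr0 sqrtr_sqr. Qed.

Lemma normc_Re (z : C) : `|complex.Re z| <= normc z.
Proof.
case: z => a b /=; rewrite -sqrtr_sqr ler_wsqrtr //.
by rewrite lerDl sqr_ge0.
Qed.

Lemma normc_Im (z : C) : `|complex.Im z| <= normc z.
Proof.
case: z => a b /=; rewrite -sqrtr_sqr ler_wsqrtr //.
by rewrite lerDr sqr_ge0.
Qed.

Lemma normc_le_ReIm (z : C) : normc z <= `|complex.Re z| + `|complex.Im z|.
Proof.
case: z => a b /=.
rewrite -[leRHS]ger0_norm ?addr_ge0 // -sqrtr_sqr ler_wsqrtr //.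
rewrite sqrrD !real_normK ?num_real //.
by rewrite addrAC lerDl mulrn_wge0 // mulr_ge0.
Qed.

Lemma complex_geometric_limit (z : nat -> C) D :
  (forall k, normc (z k) <= D * h ^+ k) ->
  exists l, forall K, normc (\sum_(k < K) z k - l) <= 4 * D * h ^+ K.
Proof.
move=> H.
have [a Ha] := @real_geometric_limit (fun k => complex.Re (z k)) D
  (fun k => le_trans (normc_Re _) (H k)).
have [b Hb] := @real_geometric_limit (fun k => complex.Im (z k)) D
  (fun k => le_trans (normc_Im _) (H k)).
exists (a +i* b) => K; apply: (le_trans (normc_le_ReIm _)).
have -> : \sum_(k < K) z k =
    (\sum_(k < K) complex.Re (z k)) +i* (\sum_(k < K) complex.Im (z k)).
  elim: K => [|K IH]; first by rewrite !big_ord0.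
  by rewrite !big_ord_recr /= IH; case: (z K).
by have := Ha K; have := Hb K; rewrite /= -!/(_ - _); lra.
Qed.

Lemma normc_sqrtC_nat n : normc (sqrtC n%:R) = Num.sqrt n%:R.
Proof.
apply/eqP; rewrite -(@eqrXn2 _ 2) ?normc_ge0 ?sqrtr_ge0 //.
rewrite sqr_sqrtr ?ler0n // expr2 -Normc.normcM -expr2 sqrtCK.
by rewrite -[n%:R]/(n%:R : C) -(rmorph_nat (real_complex R)) normc_real ger0_norm ?ler0n.
Qed.

Lemma sum_half_mdeg m : exists W : R, forall B : nat,
  \sum_(n : 'X_{1..m < B}) (h ^+ mdeg n) ^+ 2 <= W.
Proof.
(* Embedding the simplex in a cube factors the sum into [m] geometric sums of ratio [1/4], each at
   most [4/3], hence below [2]. *)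
exists (2 ^+ m) => B.
pose q (f : {ffun 'I_m -> 'I_B.+1}) : R := \prod_i (h ^+ f i) ^+ 2.
pose g (n : 'X_{1..m < B}) : {ffun 'I_m -> 'I_B.+1} := [ffun i => inord (n i)].
have gE n i : g n i = n i :> nat.
  rewrite ffunE inordK // ltnW // ltnS (leq_ltn_trans _ (bmdeg n)) //.
  by rewrite mdegE (bigD1 i) //= leq_addr.
have ginj : injective g.
  move=> n1 n2 E; apply/val_inj/mnmP => i.
  by rewrite -!gE E.
have -> : \sum_(n : 'X_{1..m < B}) (h ^+ mdeg n) ^+ 2 =
          \sum_(n in [set: 'X_{1..m < B}]%SET) q (g n).
  apply: eq_big => [n|n _]; first by rewrite inE.
  rewrite /q prodrXl; congr (_ ^+ 2).
  by rewrite mdegE expr_sum; apply: eq_bigr => i _; rewrite gE.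
rewrite -(big_imset q) /=; last by move=> x y _ _; apply: ginj.
apply: (@le_trans _ _ (\sum_f q f)).
  rewrite big_mkcond; apply: ler_sum => f _; case: ifP => // _.
  by rewrite prodr_ge0 // => i _; rewrite sqr_ge0.
rewrite /q -(bigA_distr_bigA (fun _ (j : 'I_B.+1) => (h ^+ j) ^+ 2)) /=.
rewrite -[X in _ <= _ ^+ X]card_ord -prodr_const.
apply: ler_prod => i _; apply/andP; split.
  by apply: sumr_ge0 => j _; rewrite sqr_ge0.
suff H N : 3 * \sum_(j < N) (h ^+ j) ^+ 2 <= 4 - 4 * (h ^+ N) ^+ 2.
  by have := H B.+1; have := sqr_ge0 (h ^+ B.+1); lra.
elim: N => [|N IH]; first by rewrite big_ord0 expr0; lra.
rewrite big_ord_recr /= [h ^+ N.+1]exprS [(_ * _) ^+ 2]exprMn.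
move: IH; set y := (h ^+ N) ^+ 2.
by lra.
Qed.

Lemma bounded_ratio (u q : nat -> R) k0 :
  (forall k, 0 <= u k) -> (forall k, u k.+1 = u k * q k) ->
  (forall k, (k0 <= k)%N -> q k <= 1) -> exists D, forall k, u k <= D.
Proof.
move=> u0 uS q1; exists (\sum_(i < k0.+1) u i) => k.
have le_u i : (i <= k0)%N -> u i <= \sum_(i < k0.+1) u i.
  move=> ik; have ik' : (i < k0.+1)%N by [].
  rewrite (bigD1 (Ordinal ik')) //= lerDl.
  by apply: sumr_ge0 => j _.
have [|/ltnW kk] := leqP k k0; first exact: le_u.
rewrite -(subnKC kk); elim: (k - k0)%N => [|j IH]; first by rewrite addn0 le_u.
apply: le_trans IH; rewrite addnS uS ler_piMr //.
by apply: q1; rewrite leq_addr.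
Qed.

End GeometricBounds.

(* [gam k a] is the constant term of [(d/dy - y)^k y^a]. *)
Section VacuumAmplitude.
Variable R : realType.
Local Notation C := R[i].
Local Notation h := (2^-1 : R).

Fixpoint gam (k a : nat) : R :=
  if k is k'.+1 then a%:R * gam k' a.-1 - gam k' a.+1 else (a == 0%N)%:R.

(** This reflects the relation [[d/dy - y, y] = 1]: moving one [y] to the left past the power leaves
    [k.+1] times the lower power, and a multiple of [y] has no constant term. *)
Lemma gamSS k a : gam k.+1 a.+1 = k.+1%:R * gam k a.
Proof.
elim: k a => [|k IH] a.
  by rewrite /= subr0 mul1r; case: a => [|a]; rewrite ?mulr1 ?mulr0.
rewrite [LHS]/= -/(gam k.+1 a) -/(gam k.+1 a.+2) [gam _ a.+2]IH.
have : k.+1%:R * (a%:R * gam k a.-1 - gam k a.+1) = k.+1%:R * gam k.+1 a by [].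
case: a => [|a].
  by move=> /= E; rewrite mul1r [k.+2%:R]mulrS mulrDl mul1r -E; ring.
rewrite IH /= => E.
have -> : a.+2%:R * (k.+1%:R * gam k a) - k.+1%:R * gam k a.+2 =
    k.+1%:R * (a.+1%:R * gam k a - gam k a.+2) + k.+1%:R * gam k a by ring.
by rewrite E; ring.
Qed.

Lemma gam_gt k a : (k < a)%N -> gam k a = 0.
Proof.
elim: k a => [|k IH] [|a] //; rewrite ltnS => ka.
by rewrite gamSS IH ?mulr0.
Qed.

Definition vac k : R := gam k 0 / (k`!)%:R.

(** The exponential series on [y^a] is the series on [1] delayed by [a] terms. All powers of [y]
    thus get the same amplitude, which is why [y] is effectively set to [1]. *)
Lemma gam_vac k a : gam (k + a) a / ((k + a)`!)%:R = vac k.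
Proof.
elim: a => [|a IH]; first by rewrite addn0.
rewrite addnS gamSS factS natrM -mulf_div divff ?mul1r // pnatr_eq0 //.
Qed.

Lemma vac0 : vac 0 = 1.
Proof. by rewrite /vac /= divr1. Qed.

Lemma vac1 : vac 1 = 0.
Proof. by rewrite /vac /= mul0r subr0 mul0r. Qed.

(** The recursion of the Taylor coefficients of [exp(-t^2/2)]. *)
Lemma vacSS k : vac k.+2 = - (vac k / k.+2%:R).
Proof.
have -> : vac k.+2 = - gam k.+1 1 / (k.+2`!)%:R by rewrite /vac /= mul0r sub0r.
rewrite gamSS !factS !natrM /vac mulNr; congr (- _).
have H1 : (k`!)%:R != 0 :> R by rewrite pnatr_eq0 -lt0n fact_gt0.
have H2 : k.+1%:R != 0 :> R by rewrite pnatr_eq0.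
have H3 : k.+2%:R != 0 :> R by rewrite pnatr_eq0.
move: (gam k 0) (k`!%:R) (k.+1%:R) (k.+2%:R) H1 H2 H3 => g x y z x0 y0 z0.
by field; rewrite x0 y0 z0.
Qed.

Lemma vac_bound k : `|vac k| <= 2 * h ^+ k.
Proof.
suff : `|vac k| <= 2 * h ^+ k /\ `|vac k.+1| <= 2 * h ^+ k.+1 by case.
elim: k => [|[|[|k]] [IH1 IH2]]; first by rewrite vac0 vac1 normr1 normr0; split; lra.
  split=> //; rewrite vacSS vac0 normrN normrM normr1 mul1r normfV ger0_norm ?ler0n //.
  by rewrite expr2; lra.
- by split=> //; rewrite vacSS vac1 mul0r oppr0 normr0 mulr_ge0 // ltW // half_exp_gt0.
split=> //; rewrite vacSS normrN normrM normfV (ger0_norm (ler0n R k.+4)).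
rewrite ler_pdivrMr ?ltr0n //; apply: (le_trans IH1).
rewrite (halfS _ k.+2) (halfS _ k.+3).
have : 4 <= k.+4%:R :> R by rewrite ler_nat.
by have := half_exp_gt0 R k.+4; nra.
Qed.

Lemma vac_limit : exists2 l : R, l != 0 &
  forall K, `|\sum_(k < K) vac k - l| <= 4 * h ^+ K.
Proof.
have [l Hl] := real_geometric_limit vac_bound; exists l; last first.
  by move=> K; have := Hl K; lra.
(* The first four terms add up to [1/2], and the error bound there is [1/4], so the limit is
   nonzero. *)
have := Hl 4%N; rewrite !big_ord_recr big_ord0 /= !vacSS vac0 vac1.
rewrite ler_norml => /andP [_]; rewrite !exprS expr0 => H.
by apply/eqP => l0; rewrite l0 in H; lra.
Qed.

Variable m : nat.
Implicit Types (P : {mpoly C[m.+1]}) (n : 'X_{1..m}).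

(** The operator [a - a^dag] of mode [0], in terms of polynomials. *)
Definition gen P : {mpoly C[m.+1]} := P^`M(ord0) - 'X_ord0 * P.

Lemma insert_succ a n :
  (insert_mnm ord0 a n + U_(ord0))%MM = insert_mnm ord0 a.+1 n.
Proof.
apply: insert_mnm_eq => [|i]; first by rewrite mnmDE insert_mnm_id mnm1E eqxx addn1.
by rewrite mnmDE insert_mnm_lift mnm1E (negPf (neq_lift _ _)) addn0.
Qed.

Lemma insert_pred a n :
  (insert_mnm ord0 a.+1 n - U_(ord0))%MM = insert_mnm ord0 a n.
Proof. by rewrite -insert_succ addmK. Qed.

Lemma gen_coef P a n : (gen P)@_(insert_mnm ord0 a n) =
  a.+1%:R * P@_(insert_mnm ord0 a.+1 n) -
  (if a is a'.+1 then P@_(insert_mnm ord0 a' n) else 0).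
Proof.
rewrite mcoeffB mcoeff_deriv insert_mnm_id insert_succ mulr_natl.
rewrite mcoeff_mulX insert_mnm_id; congr (_ - _).
by case: a => [|a] //=; rewrite insert_pred.
Qed.

Lemma iter_gen_coef k P n : (iter k gen P)@_(insert_mnm ord0 0 n) =
  \sum_(a < k.+1) (gam k a)%:C * P@_(insert_mnm ord0 a n).
Proof.
elim: k P => [|k IH] P; first by rewrite big_ord1 /= mul1r.
rewrite iterSr IH; pose p a := P@_(insert_mnm ord0 a n).
transitivity (\sum_(a < k.+1) (gam k a)%:C * (a.+1%:R * p a.+1) -
              \sum_(a < k.+2) (gam k a.+1)%:C * p a).
  under eq_bigr do rewrite gen_coef mulrBr.
  rewrite sumrB; congr (_ - _).
  rewrite big_ord_recl mulr0 add0r [RHS]big_ord_recr [X in _ = X + _]big_ord_recr /=.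
  by rewrite !gam_gt ?mul0r ?addr0.
have -> : \sum_(a < k.+1) (gam k a)%:C * (a.+1%:R * p a.+1) =
          \sum_(a < k.+2) a%:R * (gam k a.-1)%:C * p a.
  rewrite [RHS]big_ord_recl mul0r mul0r add0r; apply: eq_bigr => a _ /=.
  by rewrite mulrCA mulrA.
rewrite -sumrB; apply: eq_bigr => a _ /=.
by rewrite rmorphB rmorphM rmorph_nat mulrBl.
Qed.

(** The situation after homogenization, where the other exponents determine that of ['X_ord0]. *)
Lemma iter_gen_coef1 k P n a :
  (forall b, b != a -> P@_(insert_mnm ord0 b n) = 0) ->
  (iter k gen P)@_(insert_mnm ord0 0 n) = (gam k a)%:C * P@_(insert_mnm ord0 a n).
Proof.
move=> H; rewrite iter_gen_coef; have [ak|ka] := ltnP a k.+1.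
  rewrite (bigD1 (Ordinal ak)) //= big1 ?addr0 // => b bk.
  by rewrite H ?mulr0.
rewrite gam_gt // mul0r big1 // => b _.
by rewrite H ?mulr0 // ltn_eqF // (leq_trans (ltn_ord b)).
Qed.

End VacuumAmplitude.

(** * Norm convergence of the exponential series *)

Section Displacement.
Variables (R : realType) (m : nat).
Local Notation C := R[i].
Local Notation h := (2^-1 : R).
Local Notation normc := (@Normc.normc R).
Implicit Types (P : {mpoly C[m.+1]}) (n : 'X_{1..m.+1}) (phi chi : fock R m.+1).

Lemma annihilate_fock_of j P : annihilate j (fock_of P) = fock_of P^`M(j).
Proof.
apply: funext => n; rewrite /annihilate /fock_of fnormD mcoeff_deriv.
have := sqrtCK ((n j).+1%:R : C); set a := sqrtC _ => E.
rewrite -mulr_natl -E expr2; move: (fnorm R n) (P@_ _) => f p.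
by rewrite -!mulrA [f * (a * _)]mulrCA [f * (a * _)]mulrCA.
Qed.

Local Notation step := (displacement_generator ord0 (-1 : C)).

Lemma stepE phi n : step phi n = annihilate ord0 phi n - create ord0 phi n.
Proof.
rewrite /displacement_generator rmorphN rmorph1.
by rewrite !mulN1r opprK addrC.
Qed.

Lemma step_fock_of P : step (fock_of P) = fock_of (gen P).
Proof.
apply: funext => n; rewrite stepE annihilate_fock_of create_fock_of.
by rewrite /gen /fock_of mcoeffB mulrBr.
Qed.

Lemma iter_step_fock_of k P : iter k step (fock_of P) = fock_of (iter k (@gen R m) P).
Proof. by elim: k => //= k ->; rewrite step_fock_of. Qed.

Lemma step_support phi s :
  (forall n, (s <= mdeg n)%N -> phi n = 0) ->
  forall n, (s < mdeg n)%N -> step phi n = 0.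
Proof.
move=> H n sn; rewrite stepE /annihilate /create.
rewrite [phi (n + _)%MM]H ?mulr0 ?sub0r; last first.
  by rewrite mdegD (leq_trans (ltnW sn)) // leq_addr.
have [->|n0] := eqVneq (n ord0) 0%N; first by rewrite sqrtC0 mul0r oppr0.
by rewrite H ?mulr0 ?oppr0 // -ltnS mdeg_subS.
Qed.

(** With fewer than [s] photons before the step, every square root that meets a nonzero amplitude is
    at most that of [s]; creation and annihilation contribute once each. *)
Lemma step_bound phi s B :
  (forall n, (s <= mdeg n)%N -> phi n = 0) ->
  (forall n, normc (phi n) <= B) ->
  forall n, normc (step phi n) <= B * (2 * Num.sqrt s%:R).
Proof.
move=> H HB n.
have B0 : 0 <= B by apply: le_trans (HB n); apply: normc_ge0.
have [sn|ns] := ltnP s (mdeg n).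
  rewrite (step_support H sn) Normc.normc0.
  by rewrite !mulr_ge0 ?sqrtr_ge0.
have sq_le a (z : C) : normc z <= B -> (a <= s)%N ->
    normc (sqrtC a%:R * z) <= B * Num.sqrt s%:R.
  move=> zB as'; rewrite Normc.normcM normc_sqrtC_nat mulrC.
  by apply: ler_pM; rewrite ?normc_ge0 ?sqrtr_ge0 // ler_wsqrtr // ler_nat.
rewrite stepE mulrCA mulr_natl mulr2n.
apply: (le_trans (normcD _ _)); apply: lerD; last first.
  rewrite -mulN1r Normc.normcM (_ : normc (-1) = 1) ?mul1r; last first.
    by rewrite normcN Normc.normc1.
  by apply: sq_le => //; apply: leq_trans ns; rewrite mdegE (bigD1 ord0) //= leq_addr.
have [sn|nlt] := leqP s (mdeg n).
  rewrite /annihilate H ?mulr0 ?Normc.normc0 ?mulr_ge0 ?sqrtr_ge0 //.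
  by rewrite mdegD (leq_trans sn) // leq_addr.
apply: sq_le => //; apply: leq_ltn_trans nlt.
by rewrite mdegE (bigD1 ord0) //= leq_addr.
Qed.

Lemma iter_step_bound phi s B :
  (forall n, (s <= mdeg n)%N -> phi n = 0) ->
  (forall n, normc (phi n) <= B) -> forall k,
  (forall n, (s + k <= mdeg n)%N -> iter k step phi n = 0) /\
  (forall n, normc (iter k step phi n) <=
     B * \prod_(i < k) (2 * Num.sqrt (s + i)%:R)).
Proof.
move=> H HB; elim=> [|k [IH1 IH2]]; first by rewrite addn0 big_ord0 mulr1.
split=> n; first by rewrite addnS => sn; apply: step_support sn.
by rewrite big_ord_recr /= mulrA; apply: step_bound.
Qed.

(** The factorial beats the product of square roots, even after multiplication by [4 ^+ k]. Of the
    resulting [4^-k], one half power [2^-k] is kept for summing over [k]; the other gives decay in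
    [n], because the [k]-th term has fewer than [s + k] photons. *)
Lemma exp_series_bound phi s B :
  (forall n, (s <= mdeg n)%N -> phi n = 0) ->
  (forall n, normc (phi n) <= B) ->
  exists D : R, forall n k,
    normc ((k`!%:R)^-1 * iter k step phi n) <= D * h ^+ mdeg n * h ^+ k.
Proof.
move=> H HB.
have B0 : 0 <= B by apply: le_trans (HB 0%MM); apply: normc_ge0.
pose u k : R := (k`!%:R)^-1 * (B * \prod_(i < k) (2 * Num.sqrt (s + i)%:R)) * 4 ^+ k.
pose q k : R := 8 * Num.sqrt (s + k)%:R / k.+1%:R.
(* The ratio [q k] is at most [1] once [64 * (s + k) <= k.+1 ^ 2], which holds from this threshold
   on. *)
have [||k ks|D HD] := @bounded_ratio R u q (64 * s.+1).
- move=> k; rewrite /u !mulr_ge0 ?invr_ge0 ?ler0n ?exprn_ge0 //.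
  by rewrite prodr_ge0 // => i _; rewrite mulr_ge0 ?sqrtr_ge0.
- move=> k; rewrite /u /q big_ord_recr /= factS natrM invfM exprS.
  by ring.
- rewrite /q ler_pdivrMr ?ltr0n // mul1r -[leRHS]ger0_norm ?ler0n // -sqrtr_sqr.
  have -> : 8 = Num.sqrt (8 ^+ 2) :> R by rewrite sqrtr_sqr ger0_norm.
  rewrite -sqrtrM ?exprn_ge0 // ler_wsqrtr // -!natrX -natrM ler_nat.
  have : (64 * s.+1 * k.+1 <= k * k.+1)%N by rewrite leq_mul2r ks orbT.
  move: ks; rewrite !expnS expn0; nia.
exists (D * 2 ^+ s) => n k; rewrite Normc.normcM.
have D0 : 0 <= D.
  apply: le_trans (HD 0%N); rewrite /u !mulr_ge0 ?invr_ge0 ?ler0n //.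
  by rewrite big_ord0.
have [H1 H2] := iter_step_bound H HB k.
have -> : normc (k`!%:R)^-1 = (k`!%:R)^-1.
  by rewrite Normc.normcV -(rmorph_nat (real_complex R)) normc_real ger0_norm ?ler0n.
have [sn|ns] := leqP (s + k) (mdeg n).
  by rewrite H1 // Normc.normc0 mulr0 !mulr_ge0 ?exprn_ge0 ?invr_ge0.
apply: (@le_trans _ _ (D * (h ^+ k * h ^+ k))).
  have Eh : (h ^+ k * h ^+ k) = (4 ^+ k)^-1.
    by rewrite -exprMn -invfM -natrM exprVn.
  rewrite Eh ler_pdivlMr ?exprn_gt0 //; apply: le_trans (HD k).
  rewrite /u ler_pM2r ?exprn_gt0 //; apply: ler_wpM2l; last exact: H2.
  by rewrite invr_ge0 ler0n.
rewrite mulrA -!mulrA ler_wpM2l // mulrA ler_pM2r ?half_exp_gt0 //.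
rewrite exprVn -ler_pdivrMl ?exprn_gt0 // exprVn -invfM lef_pV2 ?posrE ?mulr_gt0 ?exprn_gt0 //.
by rewrite -exprD -!natrX ler_nat leq_exp2l // ltnW.
Qed.

(** The limit is built amplitude by amplitude; decay of the error in [n] makes it a limit in norm.
    The pointwise rate is kept to identify the amplitudes after projection. *)
Lemma displaced_fock_of P : exists chi, displaced ord0 (-1) (fock_of P) chi /\
  forall n, exists D : R, forall K,
    normc (\sum_(k < K) (k`!%:R)^-1 * fock_of (iter k (@gen R m) P) n - chi n)
      <= D * h ^+ K.
Proof.
have [|n|D HD] := @exp_series_bound (fock_of P) (msize P)
    (\sum_(n <- msupp P) normc (fock_of P n)).
- by move=> n /msize_mdeg_ge; rewrite /fock_of => /memN_msupp_eq0 ->; rewrite mulr0.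
- have [nP|nP] := boolP (n \in msupp P).
    rewrite (bigD1_seq n nP (msupp_uniq _)) /= lerDl.
    by apply: sumr_ge0 => l _; apply: normc_ge0.
  rewrite /fock_of (memN_msupp_eq0 nP) mulr0 Normc.normc0.
  by apply: sumr_ge0 => l _; apply: normc_ge0.
have [chi Hchi] := choice (fun n => complex_geometric_limit (HD n)).
exists chi; split; last first.
  move=> n; exists (4 * (D * h ^+ mdeg n)) => K.
  apply: le_trans (Hchi n K); rewrite le_eqVlt; apply/orP; left; apply/eqP.
  by congr (normc (_ - _)); apply: eq_bigr => k _; rewrite iter_step_fock_of.
have [W HW] := sum_half_mdeg R m.+1.
(* The sum over [n] of the squared pointwise errors [4 * D * h ^+ mdeg n * h ^+ K]. *)
pose e K : R := 16 * D ^+ 2 * W * (4^-1) ^+ K.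
have He K : (normsq (fun n => \sum_(k < K) (k`!%:R)^-1 * iter k step (fock_of P) n
     - chi n)%R <= (e K)%:E)%E.
  apply: normsq_le => N; rewrite lee_fin.
  apply: (@le_trans _ _ (\sum_(n : 'X_{1..m.+1 < N})
     16 * D ^+ 2 * (4^-1) ^+ K * (h ^+ mdeg n) ^+ 2)).
    apply: ler_sum => n _; apply: (@le_trans _ _ ((4 * (D * h ^+ mdeg n) * h ^+ K) ^+ 2)).
      by rewrite ler_sqr ?nnegrE ?normc_ge0 // (le_trans (normc_ge0 _) (Hchi n K)).
    rewrite le_eqVlt; apply/orP; left; apply/eqP.
    have -> : (4^-1 : R) ^+ K = h ^+ K * h ^+ K.
      by rewrite -exprMn -invfM -natrM.
    ring.
  rewrite -mulr_sumr /e [leRHS]mulrAC ler_wpM2l // mulr_ge0 ?exprn_ge0 ?invr_ge0 //.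
  by rewrite mulr_ge0 // sqr_ge0.
apply: (@squeeze_cvge _ _ _ _ (fun=> 0%E) _ (fun K => (e K)%:E)).
- by apply: nearW => K; rewrite He andbT; apply: esum_ge0 => n _; rewrite lee_fin sqr_ge0.
- exact: cvg_cst.
apply: cvg_EFin; first exact: nearW.
rewrite /e -[X in _ --> X](mulr0 (16 * D ^+ 2 * W)).
apply: cvgMr; apply: cvg_expr.
by rewrite ger0_norm ?invr_ge0 // invf_lt1 // ltr1n.
Qed.

End Displacement.

(** * The inhomogeneous case *)

Section Homogenization.
Variables (R : realType) (M : nat).
Local Notation C := R[i].

Lemma homogenize_coef (K : fieldType) (P : {mpoly K[M]}) a n :
  (homogenize P)@_(insert_mnm ord0 a n) =
  if a == ((msize P).-1 - mdeg n)%N then P@_n else 0.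
Proof.
rewrite /homogenize raddf_sum /=.
have E l : (P@_l *: 'X_[insert_mnm ord0 ((msize P).-1 - mdeg l) l])@_(insert_mnm ord0 a n)
    = if (l == n) && (a == ((msize P).-1 - mdeg n)%N) then P@_n else 0.
  rewrite mcoeffZ mcoeffX; have [->|ln] /= := eqVneq l n.
    rewrite [in RHS]eq_sym; case: eqP => [E|NE].
      by rewrite (_ : _ == a) ?mulr1 //; move/mnmP: E => /(_ ord0);
        rewrite !insert_mnm_id => ->.
    by case: eqP NE => [->|_] //; rewrite mulr0.
  case: eqP => [E|_]; last by rewrite mulr0.
  case/eqP: ln; apply/mnmP => i; move/mnmP: E => /(_ (lift ord0 i)).
  by rewrite !insert_mnm_lift.
under eq_bigr do rewrite E.
have [nP|nP] := boolP (n \in msupp P); last first.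
  rewrite (memN_msupp_eq0 nP) if_same big1 // => l _; by rewrite if_same.
rewrite (bigD1_seq n nP (msupp_uniq _)) /= eqxx big1 ?addr0 //.
by move=> l /negPf ->.
Qed.

(** For each [n] a single power of the homogenizing variable occurs, and the displaced vacuum
    projection gives every power the same nonzero factor [l]; the result is therefore proportional
    to [psi]. *)
Lemma homogenize_two_ancilla (psi : fock R M) d N (U : 'M[C]_(N, M.+1)) :
  core_state psi -> stellar psi != 0 -> homogenize (stellar psi) = esym_lin d U ->
  two_ancilla N N (N - d) psi.
Proof.
move=> cs s0 E; set P := stellar psi in s0 E.
have [dN|Nd] := leqP d N; last first.
  case/eqP: s0; apply/mpolyP => n.
  have := homogenize_coef P ((msize P).-1 - mdeg n) n.
  by rewrite eqxx E esym_lin_gt // !mcoeff0 => <-.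
have [phi [c [rphi c0 H]]] := prepare_esym_lin U dN.
exists phi => //.
have Ephi : project ord_max (N - d) phi = fock_of (c *: homogenize P).
  by apply: funext => n; rewrite H E /fock_of mcoeffZ mulrCA.
have [chi [Hchi lim]] := displaced_fock_of (c *: homogenize P).
exists (-1), chi; split; first by rewrite Ephi.
have [l l0 Hl] := vac_limit R.
exists (l%:C * c) => [|n].
  rewrite mulf_neq0 //; apply: contraNneq l0 => El.
  by apply/eqP; apply: (complexI El).
pose a := ((msize P).-1 - mdeg n)%N.
pose x := fnorm R n * (c * P@_n).
have -> : l%:C * c * psi n = l%:C * x.
  by rewrite -[psi in LHS](stellarK cs) -/P /fock_of /x [fnorm R n * (c * _)]mulrCA [RHS]mulrA.
have [D HD] := lim (insert_mnm ord0 0 n).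
(* The first [a] terms vanish; the following ones form the vacuum series times [x]. *)
have S K : \sum_(k < a + K)
    (k`!%:R)^-1 * fock_of (iter k (@gen R M) (c *: homogenize P)) (insert_mnm ord0 0 n)
    = (\sum_(k < K) vac R k)%:C * x.
  have T k : (k`!%:R)^-1 * fock_of (iter k (@gen R M) (c *: homogenize P))
      (insert_mnm ord0 0 n) = (gam R k a / k`!%:R)%:C * x.
    rewrite /fock_of (@iter_gen_coef1 _ _ _ _ _ a) => [|b ba]; last first.
      by rewrite mcoeffZ homogenize_coef (negPf ba) mulr0.
    rewrite mcoeffZ homogenize_coef eqxx fnorm_insert fact0 sqrtC1 mul1r.
    rewrite rmorphM fmorphV rmorph_nat /x.
    by rewrite [fnorm R n * ((gam R k a)%:C * _)]mulrCA [LHS]mulrCA -[RHS]mulrA.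
  rewrite big_split_ord /= big1 ?add0r => [|k _]; last first.
    by rewrite T gam_gt // mul0r mul0r.
  rewrite rmorph_sum mulr_suml; apply: eq_bigr => k _.
  by rewrite T /= addnC gam_vac.
have nx := normc_ge0 x.
apply/eqP; rewrite -subr_eq0; apply/eqP; apply: Normc.eq0_normc.
(* Both the amplitude of [chi] and [l%:C * x] are geometrically close to the same partial sums,
   hence equal. *)
apply: (@half_small _ (D + 4 * Normc.normc x)) => [|K]; first exact: normc_ge0.
rewrite [project _ _ _ _]/project.
set z := chi _.
have -> : z - l%:C * x = ((\sum_(k < K) vac R k - l)%:C * x) -
    ((\sum_(k < K) vac R k)%:C * x - z).
  by rewrite rmorphB /= mulrBl opprB [RHS]addrC addrA subrK.
apply: (le_trans (normcD _ _)); rewrite mulrDl addrC; apply: lerD; last first.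
  rewrite Normc.normcM normc_real mulrAC; apply: ler_wpM2r => //; exact: Hl.
rewrite (normcN (_ - z)) -S; apply: (le_trans (HD _)).
have D0 : 0 <= D.
  by have := HD 0%N; rewrite expr0 mulr1; apply: le_trans; apply: normc_ge0.
apply: ler_wpM2l => //; rewrite addnC exprD.
by rewrite ler_piMr ?exprn_ge0 ?invr_ge0 // exprn_ile1 ?invr_ge0 // invf_le1 // ler1n.
Qed.

End Homogenization.

Theorem theorem2 (R : realType) (d M : nat) (hd : (0 < d)%N) (hM : (0 < M)%N) :
  [/\ exists N : nat, forall P : {mpoly R[i][M]}, P \is d.-homog ->
        exists U : 'M[R[i]]_(N, M), P = esym_lin d U,

      forall psi : fock R M, core_state psi -> msize (stellar psi) = d.+1 ->
        (stellar psi \is d.-homog ->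
          forall (N : nat) (U : 'M[R[i]]_(N, M)),
            stellar psi = esym_lin d U ->
            single_ancilla N N (N - d) psi) /\
        (stellar psi \isn't d.-homog ->
          forall (N : nat) (U : 'M[R[i]]_(N, M.+1)),
            homogenize (stellar psi) = esym_lin d U ->
            two_ancilla N N (N - d) psi)

    & forall (psi : fock R M) (N : nat), core_state psi ->
        stellar psi \is d.-homog ->
        mpoly_irreducible (stellar psi) ->
        (exists U : 'M[R[i]]_(N, M), stellar psi = esym_lin d U) ->
        (forall (N' : nat) (U : 'M[R[i]]_(N', M)),
            stellar psi = esym_lin d U -> (N <= N')%N) ->
        single_ancilla N N (N - d) psi /\
        (forall p q k : nat, single_ancilla p q k psi -> (N <= p)%N)].
Proof.
split; first exact: homog_esym_lin.
  move=> psi cs ms; have s0 : stellar psi != 0 by rewrite -msize_poly_eq0 ms.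
  split=> _ N U; first exact: stellar_homog_single_ancilla.
  exact: homogenize_two_ancilla.
move=> psi N cs hom irr [U EU] minN; have s0 : stellar psi != 0 by case: irr.
split; first exact: stellar_homog_single_ancilla EU.
by move=> p q k; apply: (single_ancilla_bound cs hom irr minN hd).
Qed.
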